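(* Let $1\le p\le\infty$ and let $g\in H(\mathbb{D})$ have the property that $V_g\colon H^p\to H^p$ is compact. Then $H^p$ is a proper subspace of $[V_g,H^p]=[T_g,H^p]$.
   Context: $\mathbb{D}=\{z\in\mathbb{C}:|z|<1\}$; $H(\mathbb{D})$ is the Fréchet space of all analytic functions on $\mathbb{D}$ with the topology of uniform convergence on compact sets; $H^p$ ($1\le p\le\infty$) is the classical Hardy space on $\mathbb{D}$ with norm $\|f\|_p:=\sup_{0\le r<1}\left(\frac1{2\pi}\int_0^{2\pi}|f(re^{i\theta})|^p\,d\theta\right)^{1/p}$ for $p<\infty$ and $\|f\|_\infty:=\sup_{z\in\mathbb{D}}|f(z)|$. For $g,f\in H(\mathbb{D})$, $(V_gf)(z):=\int_0^z f(\xi)g'(\xi)\,d\xi$ for $z\in\mathbb{D}$, and $(T_gf)(z):=\frac1z\int_0^z f(\xi)g'(\xi)\,d\xi$ for $z\in\mathbb{D}\setminus\{0\}$, $(T_gf)(0):=f(0)g'(0)$. For $X$ a Banach space continuously included in $H(\mathbb{D})$ and $T\colon H(\mathbb{D})\to H(\mathbb{D})$ continuous linear with $T(X)\subseteq X$, the optimal domain is $[T,X]:=\{f\in H(\mathbb{D}):Tf\in X\}$ with (semi-)norm $\|f\|_{[T,X]}:=\|Tf\|_X$. Saying that $T\colon X\to X$ is compact includes that $T(X)\subseteq X$. *)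

(* Defs.v *)
From Stdlib Require Import Reals.
From Coquelicot Require Import Coquelicot.
Open Scope R_scope.

(* A function on the open unit disc is represented by a total function C -> C.
   Its values outside the disc are junk: no notion below depends on them, so two
   functions that agree on the disc stand for the same element of H(D). *)

Definition disc (z : C) : Prop := Cmod z < 1.

Definition analytic_on_disc (f : C -> C) : Prop :=
  forall z : C, disc z -> @ex_derive C_AbsRing C_NormedModule f z.

(* x^s for x >= 0 and s > 0; Rpower alone has Rpower 0 s = 1. *)
Definition rpow (x s : R) : R :=
  if Req_dec_T x 0 then 0 else Rpower x s.

Definition circle_point (r theta : R) : C := (r * cos theta, r * sin theta).

Definition circle_mean (p r : R) (f : C -> C) : R :=
  rpow (/ (2 * PI)
        * RInt (fun theta => rpow (Cmod (f (circle_point r theta))) p) 0 (2 * PI))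
       (/ p).

(* Valued in the extended reals: the norm is p_infty exactly when the supremum
   is infinite. The value at p = m_infty is irrelevant, since 1 <= p is assumed
   wherever this is used. *)
Definition hardy_norm (p : Rbar) (f : C -> C) : Rbar :=
  match p with
  | Finite q => Lub_Rbar (fun x => exists r, 0 <= r < 1 /\ x = circle_mean q r f)
  | p_infty => Lub_Rbar (fun x => exists z, disc z /\ x = Cmod (f z))
  | m_infty => p_infty
  end.

Definition hardy (p : Rbar) (f : C -> C) : Prop :=
  analytic_on_disc f /\ Rbar_lt (hardy_norm p f) p_infty.

(* The integral from 0 to z is taken along the segment xi = t z, 0 <= t <= 1. *)
Definition V_op (g f : C -> C) (z : C) : C :=
  RInt (V := C_R_CompleteNormedModule)
    (fun t : R => (f (RtoC t * z) * C_derive g (RtoC t * z) * z)%C) 0 1.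

Definition T_op (g f : C -> C) (z : C) : C :=
  if Ceq_dec z 0 then (f 0 * C_derive g 0)%C else (/ z * V_op g f z)%C.

Definition optimal_domain (A : (C -> C) -> C -> C) (X : (C -> C) -> Prop)
  (f : C -> C) : Prop :=
  analytic_on_disc f /\ X (A f).

(* A maps X into X, and the image of every norm-bounded sequence of X has a
   subsequence converging in norm to an element of X. *)
Definition compact_operator (X : (C -> C) -> Prop) (N : (C -> C) -> Rbar)
  (A : (C -> C) -> C -> C) : Prop :=
  (forall f, X f -> X (A f)) /\
  forall u : nat -> C -> C,
    (forall n, X (u n)) ->
    (exists M : R, forall n, Rbar_le (N (u n)) M) ->
    exists (phi : nat -> nat) (h : C -> C),
      (forall n, (phi n < phi (S n))%nat) /\
      X h /\
      forall eps : R, 0 < eps ->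
        eventually (fun n =>
          Rbar_lt (N (fun z => (A (u (phi n)) z - h z)%C)) eps).

Definition linear_subspace (X : (C -> C) -> Prop) : Prop :=
  X (fun _ => RtoC 0) /\
  (forall f h, X f -> X h -> X (fun z => (f z + h z)%C)) /\
  (forall (c : C) f, X f -> X (fun z => (c * f z)%C)).

Definition proper_subspace (X Y : (C -> C) -> Prop) : Prop :=
  linear_subspace X /\ linear_subspace Y /\
  (forall f, X f -> Y f) /\
  exists f, Y f /\ ~ X f.

(* Main.v *)
(* The monomials [z^n] are bounded in [H^p] and [V z^n] tends to [0] uniformly on
   compact sets, so compactness of [V = V_g] makes the [H^p] norm of [V z^n]
   arbitrarily small for suitable large [n]. A lacunary series [f] whose nonzero
   coefficients are 1, 2, 3, ... at sufficiently good exponents [n] then has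
   [V f] in [H^p], while [f] is not in [H^p] since its Taylor coefficients are
   unbounded. On the disc [V f = z * T f], which relates the two optimal domains.

   Analyticity is only assumed as pointwise complex differentiability, so Taylor
   expansions are obtained from Goursat's bisection argument: in the coordinate
   [log z] it shows that circle means do not depend on the radius. *)
From Stdlib Require Import Reals Lra Lia Classical ClassicalEpsilon.
From Coquelicot Require Import Coquelicot.
Require Import Defs.
Open Scope R_scope.

(** * Complex differentiability *)

(** Bounds in [H^p] are kept circle by circle, with one constant for all radii, and the
    extended-real supremum is met only on entering or leaving [hardy_norm]. The price is a triangle
    inequality with an extra factor 4. It fixes the demand on the exponents: the [k]-th one used
    ([k = 1, 2, ...]) must make the norm of [V z^n] at most [8^(-k) / k]. The divisor [k] pays for
    the coefficient, and [8 = 4 * 2] pays for adding two quantities of equal size with loss 4.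
    Exponents are selected while [n] runs upwards, so the coefficient at [n] never exceeds [n + 1]
    and the series converges on the disc however the gaps fall. Compactness is used only to see that
    the selection never stops. That [V f] lies in [H^p] is seen on one circle at a time: there [f]
    is uniformly close to a partial sum, and [V] of every partial sum obeys a bound independent of
    its length and of the radius. *)

Definition cderiv (f : C -> C) (z l : C) : Prop :=
  forall eps, 0 < eps -> exists d, 0 < d /\ forall w, Cmod (w - z) < d ->
    Cmod (f w - f z - l * (w - z)) <= eps * Cmod (w - z).

Definition ccont (f : C -> C) (z : C) : Prop :=
  forall eps, 0 < eps -> exists d, 0 < d /\ forall w, Cmod (w - z) < d ->
    Cmod (f w - f z) < eps.

(** Replaces the filter formulation over [C_AbsRing] by an estimate on [Cmod], the form in which all
    the calculus below is done. *)
Lemma is_derive_cderiv (f : C -> C) (z l : C) :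
  @is_derive C_AbsRing C_NormedModule f z l <-> cderiv f z l.
Proof.
split.
- intros [_ H] eps He.
  destruct (H z (fun P HP => HP) (mkposreal eps He)) as [d Hd].
  exists d; split; [apply cond_pos|]. intros w Hw.
  generalize (Hd w Hw).
  replace (f w - f z - l * (w - z))%C
    with (minus (minus (f w) (f z)) (scal (minus w z) l) : C); [easy|].
  change ((f w - f z) - (w - z) * l = f w - f z - l * (w - z))%C. ring.
- intros H. split; [apply is_linear_scal_l|].
  intros x Hx. apply (@is_filter_lim_locally_unique C_AbsRing (AbsRing_NormedModule C_AbsRing)) in Hx. subst x.
  intros eps. destruct (H eps (cond_pos eps)) as [d [Hd Hw]].
  exists (mkposreal d Hd). intros w Bw.
  generalize (Hw w Bw).
  replace (f w - f z - l * (w - z))%C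
    with (minus (minus (f w) (f z)) (scal (minus w z) l) : C); [easy|].
  change ((f w - f z) - (w - z) * l = f w - f z - l * (w - z))%C. ring.
Qed.

Lemma analytic_cderiv (f : C -> C) :
  analytic_on_disc f <-> forall z, disc z -> exists l, cderiv f z l.
Proof.
split; intros H z Hz; destruct (H z Hz) as [l Hl]; exists l; now apply is_derive_cderiv.
Qed.

Lemma cderiv_C_derive (f : C -> C) (z l : C) : cderiv f z l -> C_derive f z = l.
Proof. intros H. now apply is_C_derive_unique, is_derive_cderiv. Qed.

Lemma Cmod_triangle_minus (a b : C) : Cmod (a - b) <= Cmod a + Cmod b.
Proof. unfold Cminus. rewrite <- (Cmod_opp b). apply Cmod_triangle. Qed.

Lemma Cmod_minus_sym (a b : C) : Cmod (a - b) = Cmod (b - a).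
Proof. rewrite <- Cmod_opp. f_equal. ring. Qed.

Lemma Cmod_triangle_sub (a b c : C) : Cmod (a - c) <= Cmod (a - b) + Cmod (b - c).
Proof. replace (a - c)%C with ((a - b) + (b - c))%C by ring. apply Cmod_triangle. Qed.

Lemma Cmod_le_sub (a b : C) : Cmod a <= Cmod b + Cmod (a - b).
Proof. replace a with (b + (a - b))%C at 1 by ring. apply Cmod_triangle. Qed.

Lemma cderiv_lipschitz (f : C -> C) (z l : C) : cderiv f z l ->
  exists d, 0 < d /\ forall w, Cmod (w - z) < d ->
    Cmod (f w - f z) <= (Cmod l + 1) * Cmod (w - z).
Proof.
intros H. destruct (H 1 Rlt_0_1) as [d [Hd Hw]]. exists d; split; [easy|].
intros w Bw. specialize (Hw w Bw).
pose proof (Cmod_le_sub (f w - f z) (l * (w - z))) as T.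
rewrite Cmod_mult in T. lra.
Qed.

Lemma cderiv_ccont (f : C -> C) (z l : C) : cderiv f z l -> ccont f z.
Proof.
intros H eps He. destruct (cderiv_lipschitz f z l H) as [d [Hd Hw]].
pose proof (Cmod_ge_0 l) as Pl.
exists (Rmin d (eps / (Cmod l + 1))). split.
{ apply Rmin_pos; [easy|]. apply Rdiv_lt_0_compat; lra. }
intros w Bw.
assert (Cmod (w - z) < d) as B1 by (eapply Rlt_le_trans; [apply Bw|apply Rmin_l]).
assert (Cmod (w - z) < eps / (Cmod l + 1)) as B2 by (eapply Rlt_le_trans; [apply Bw|apply Rmin_r]).
eapply Rle_lt_trans; [apply Hw, B1|].
apply (Rmult_lt_compat_l (Cmod l + 1)) in B2; [|lra].
replace ((Cmod l + 1) * (eps / (Cmod l + 1))) with eps in B2 by (field; lra). easy.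
Qed.

Lemma cderiv_ext_loc (f h : C -> C) (z l : C) (d : R) : 0 < d ->
  (forall w, Cmod (w - z) < d -> f w = h w) -> cderiv f z l -> cderiv h z l.
Proof.
intros Hd E H eps He. destruct (H eps He) as [d' [Hd' Hw]].
exists (Rmin d d'). split; [now apply Rmin_pos|].
intros w Bw.
assert (Cmod (w - z) < d) as B1 by (eapply Rlt_le_trans; [apply Bw|apply Rmin_l]).
assert (Cmod (w - z) < d') as B2 by (eapply Rlt_le_trans; [apply Bw|apply Rmin_r]).
rewrite <- (E w B1), <- (E z); [now apply Hw|].
replace (z - z)%C with (RtoC 0) by ring. now rewrite Cmod_0.
Qed.

Lemma cderiv_const (c z : C) : cderiv (fun _ => c) z 0.
Proof.
intros eps He. exists 1; split; [lra|]. intros w _.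
replace (c - c - 0 * (w - z))%C with (RtoC 0) by ring. rewrite Cmod_0.
apply Rmult_le_pos; [lra|apply Cmod_ge_0].
Qed.

Lemma cderiv_id (z : C) : cderiv (fun w => w) z 1.
Proof.
intros eps He. exists 1; split; [lra|]. intros w _.
replace (w - z - 1 * (w - z))%C with (RtoC 0) by ring. rewrite Cmod_0.
apply Rmult_le_pos; [lra|apply Cmod_ge_0].
Qed.

Lemma cderiv_plus (f h : C -> C) (z l m : C) :
  cderiv f z l -> cderiv h z m -> cderiv (fun w => f w + h w)%C z (l + m).
Proof.
intros Hf Hh eps He.
destruct (Hf (eps / 2)) as [d1 [P1 H1]]; [lra|].
destruct (Hh (eps / 2)) as [d2 [P2 H2]]; [lra|].
exists (Rmin d1 d2). split; [now apply Rmin_pos|]. intros w Bw.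
assert (Cmod (w - z) < d1) as B1 by (eapply Rlt_le_trans; [apply Bw|apply Rmin_l]).
assert (Cmod (w - z) < d2) as B2 by (eapply Rlt_le_trans; [apply Bw|apply Rmin_r]).
specialize (H1 w B1). specialize (H2 w B2).
replace (f w + h w - (f z + h z) - (l + m) * (w - z))%C
  with ((f w - f z - l * (w - z)) + (h w - h z - m * (w - z)))%C by ring.
eapply Rle_trans; [apply Cmod_triangle|]. lra.
Qed.

Lemma cderiv_mult (f h : C -> C) (z l m : C) :
  cderiv f z l -> cderiv h z m ->
  cderiv (fun w => f w * h w)%C z (l * h z + f z * m).
Proof.
intros Hf Hh eps He.
(* The remainder splits into three terms, each allowed a third of [eps]; the added 1 keeps the
   divisors positive and absorbs the variation of [h]. *)
set (A := Cmod (h z) + 1). set (B := Cmod l + 1). set (D := Cmod (f z) + 1).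
assert (0 < A /\ 0 < B /\ 0 < D) as [PA [PB PD]].
{ unfold A, B, D. generalize (Cmod_ge_0 (h z)) (Cmod_ge_0 l) (Cmod_ge_0 (f z)). lra. }
destruct (Hf (eps / 3 / A)) as [d1 [P1 H1]].
{ apply Rdiv_lt_0_compat; lra. }
destruct (Hh (eps / 3 / D)) as [d2 [P2 H2]].
{ apply Rdiv_lt_0_compat; lra. }
destruct (cderiv_ccont h z m Hh (Rmin 1 (eps / 3 / B))) as [d3 [P3 H3]].
{ apply Rmin_pos; [lra|]. apply Rdiv_lt_0_compat; lra. }
exists (Rmin d1 (Rmin d2 d3)). split; [now repeat apply Rmin_pos|]. intros w Bw.
assert (Cmod (w - z) < d1) as B1 by (eapply Rlt_le_trans; [apply Bw|apply Rmin_l]).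
assert (Cmod (w - z) < Rmin d2 d3) as B2 by (eapply Rlt_le_trans; [apply Bw|apply Rmin_r]).
assert (Cmod (w - z) < d3) as B3 by (eapply Rlt_le_trans; [apply B2|apply Rmin_r]).
assert (Cmod (w - z) < d2) as B2' by (eapply Rlt_le_trans; [apply B2|apply Rmin_l]).
specialize (H1 w B1). specialize (H2 w B2'). specialize (H3 w B3).
pose proof (Rmin_l 1 (eps / 3 / B)). pose proof (Rmin_r 1 (eps / 3 / B)).
assert (Cmod (h w) <= A) as HA.
{ unfold A. pose proof (Cmod_le_sub (h w) (h z)). lra. }
replace (f w * h w - f z * h z - (l * h z + f z * m) * (w - z))%C
  with ((f w - f z - l * (w - z)) * h w + (l * (h w - h z)) * (w - z)
        + f z * (h w - h z - m * (w - z)))%C by ring.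
pose proof (Cmod_ge_0 (w - z)) as Pw.
assert (Cmod ((f w - f z - l * (w - z)) * h w) <= eps / 3 * Cmod (w - z)) as E1.
{ rewrite Cmod_mult.
  apply Rle_trans with (eps / 3 / A * Cmod (w - z) * A).
  - apply Rmult_le_compat; auto using Cmod_ge_0.
  - right. field. lra. }
assert (Cmod (l * (h w - h z) * (w - z)) <= eps / 3 * Cmod (w - z)) as E2.
{ rewrite 2!Cmod_mult. apply Rmult_le_compat_r; [easy|].
  apply Rle_trans with (B * (eps / 3 / B)).
  - apply Rmult_le_compat; auto using Cmod_ge_0; unfold B in *; lra.
  - right. field. lra. }
assert (Cmod (f z * (h w - h z - m * (w - z))) <= eps / 3 * Cmod (w - z)) as E3.
{ rewrite Cmod_mult.
  apply Rle_trans with (D * (eps / 3 / D * Cmod (w - z))).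
  - apply Rmult_le_compat; auto using Cmod_ge_0; unfold D; lra.
  - right. field. lra. }
eapply Rle_trans; [apply Cmod_triangle|].
eapply Rle_trans; [apply Rplus_le_compat_r, Cmod_triangle|]. lra.
Qed.

Lemma cderiv_scal (c : C) (f : C -> C) (z l : C) :
  cderiv f z l -> cderiv (fun w => c * f w)%C z (c * l).
Proof.
intros H. replace (c * l)%C with (0 * f z + c * l)%C by ring.
apply (cderiv_mult (fun _ => c)); [apply cderiv_const|easy].
Qed.

Lemma cderiv_comp (f h : C -> C) (z l m : C) :
  cderiv h z m -> cderiv f (h z) l -> cderiv (fun w => f (h w)) z (l * m).
Proof.
intros Hh Hf eps He.
set (M := Cmod m + 1). set (L := Cmod l + 1).
assert (0 < M /\ 0 < L) as [PM PL].
{ unfold M, L. generalize (Cmod_ge_0 m) (Cmod_ge_0 l). lra. }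
destruct (Hf (eps / 2 / M)) as [d1 [P1 H1]].
{ apply Rdiv_lt_0_compat; lra. }
destruct (Hh (eps / 2 / L)) as [d2 [P2 H2]].
{ apply Rdiv_lt_0_compat; lra. }
destruct (cderiv_lipschitz h z m Hh) as [d3 [P3 H3]].
exists (Rmin (d1 / M) (Rmin d2 d3)). split.
{ repeat apply Rmin_pos; auto. now apply Rdiv_lt_0_compat. }
intros w Bw.
assert (Cmod (w - z) < d1 / M) as B1 by (eapply Rlt_le_trans; [apply Bw|apply Rmin_l]).
assert (Cmod (w - z) < Rmin d2 d3) as B2 by (eapply Rlt_le_trans; [apply Bw|apply Rmin_r]).
assert (Cmod (w - z) < d3) as B3 by (eapply Rlt_le_trans; [apply B2|apply Rmin_r]).
assert (Cmod (w - z) < d2) as B2' by (eapply Rlt_le_trans; [apply B2|apply Rmin_l]).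
specialize (H2 w B2'). specialize (H3 w B3). fold M in H3.
assert (Cmod (h w - h z) < d1) as Bh.
{ eapply Rle_lt_trans; [apply H3|].
  apply (Rmult_lt_compat_l M) in B1; [|easy].
  replace (M * (d1 / M)) with d1 in B1 by (field; lra). easy. }
specialize (H1 (h w) Bh).
pose proof (Cmod_ge_0 (w - z)) as Pw.
replace (f (h w) - f (h z) - l * m * (w - z))%C
  with ((f (h w) - f (h z) - l * (h w - h z)) + l * (h w - h z - m * (w - z)))%C by ring.
eapply Rle_trans; [apply Cmod_triangle|]. rewrite Cmod_mult.
assert (Cmod (f (h w) - f (h z) - l * (h w - h z)) <= eps / 2 * Cmod (w - z)) as E1.
{ eapply Rle_trans; [apply H1|].
  apply Rle_trans with (eps / 2 / M * (M * Cmod (w - z))).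
  - apply Rmult_le_compat_l; [|easy]. left. apply Rdiv_lt_0_compat; lra.
  - right. field. lra. }
assert (Cmod l * Cmod (h w - h z - m * (w - z)) <= eps / 2 * Cmod (w - z)) as E2.
{ apply Rle_trans with (L * (eps / 2 / L * Cmod (w - z))).
  - apply Rmult_le_compat; auto using Cmod_ge_0; unfold L; lra.
  - right. field. lra. }
lra.
Qed.

Lemma cderiv_inv (z : C) : z <> 0 -> cderiv (fun w => / w)%C z (- / (z * z)).
Proof.
intros Hz eps He. set (a := Cmod z).
assert (0 < a) as Pa by now apply Cmod_gt_0.
assert (0 < a * a * a) as Pa3 by (repeat apply Rmult_lt_0_compat; easy).
(* The remainder is [(w - z)^2 / (w * z^2)]. The first bound forces [Cmod w > a / 2], and the second
   then makes the remainder at most [eps * Cmod (w - z)]. *)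
exists (Rmin (a / 2) (eps * (a * a * a) / 2)). split.
{ apply Rmin_pos; [lra|]. apply Rdiv_lt_0_compat; [|lra]. now apply Rmult_lt_0_compat. }
intros w Bw.
assert (Cmod (w - z) < a / 2) as B1 by (eapply Rlt_le_trans; [apply Bw|apply Rmin_l]).
assert (Cmod (w - z) < eps * (a * a * a) / 2) as B2 by (eapply Rlt_le_trans; [apply Bw|apply Rmin_r]).
assert (a / 2 < Cmod w) as Hw.
{ pose proof (Cmod_le_sub z w) as T. rewrite Cmod_minus_sym in T. fold a in T. lra. }
assert (w <> 0) as Nw by (apply Cmod_gt_0; lra).
replace (/ w - / z - - / (z * z) * (w - z))%C
  with (/ (w * (z * z)) * ((w - z) * (w - z)))%C by (field; auto).
rewrite 2!Cmod_mult, Cmod_inv, 2!Cmod_mult.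
2:{ repeat apply Cmult_neq_0; auto. }
fold a. pose proof (Cmod_ge_0 (w - z)) as Pw.
rewrite <- Rmult_assoc. apply Rmult_le_compat_r; [easy|].
apply (Rmult_le_reg_l (Cmod w * (a * a))).
{ repeat apply Rmult_lt_0_compat; lra. }
rewrite <- Rmult_assoc, Rinv_r, Rmult_1_l.
2:{ apply Rgt_not_eq. repeat apply Rmult_lt_0_compat; lra. }
apply Rle_trans with (eps * (a * a * a) / 2); [lra|].
apply Rle_trans with (a / 2 * (a * a) * eps); [right; field|].
apply Rmult_le_compat_r; [lra|]. apply Rmult_le_compat_r; nra.
Qed.

Lemma cderiv_pow (n : nat) (z : C) : exists l, cderiv (fun w => w ^ n)%C z l.
Proof.
induction n as [|n [l Hl]].
- exists 0. apply (cderiv_const 1).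
- eexists. apply (cderiv_mult (fun w => w) (fun w => w ^ n)%C); [apply cderiv_id|apply Hl].
Qed.

(** * Goursat's theorem on rectangles *)

(** The counterclockwise boundary integral of the real form [P dx + Q dy]. *)
Definition rect_int (P Q : R -> R -> R) (x1 x2 y1 y2 : R) : R :=
  RInt (fun x => P x y1) x1 x2 - RInt (fun x => P x y2) x1 x2
  + RInt (fun y => Q x2 y) y1 y2 - RInt (fun y => Q x1 y) y1 y2.

(** Fréchet differentiability at a single point, measured in the sum norm; it says nothing on how
    the derivatives vary. *)
Definition diff2 (P : R -> R -> R) (x y px py : R) : Prop :=
  forall eps, 0 < eps -> exists d, 0 < d /\
    forall x' y', Rabs (x' - x) < d -> Rabs (y' - y) < d ->
      Rabs (P x' y' - P x y - px * (x' - x) - py * (y' - y))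
      <= eps * (Rabs (x' - x) + Rabs (y' - y)).

Lemma lipschitz_continuous (f : R -> R) (x L d : R) : 0 < d ->
  (forall x', Rabs (x' - x) < d -> Rabs (f x' - f x) <= L * Rabs (x' - x)) ->
  continuous f x.
Proof.
intros Hd H. apply continuity_pt_filterlim.
intros eps He. exists (Rmin d (eps / (Rabs L + 1))).
pose proof (Rabs_pos L) as PL.
split. { apply Rmin_pos; [easy|]. apply Rdiv_lt_0_compat; lra. }
intros x' [_ Hx]. unfold dist in *. simpl in *. unfold R_dist in *.
assert (Rabs (x' - x) < d) as B1 by (eapply Rlt_le_trans; [apply Hx|apply Rmin_l]).
assert (Rabs (x' - x) < eps / (Rabs L + 1)) as B2 by (eapply Rlt_le_trans; [apply Hx|apply Rmin_r]).
eapply Rle_lt_trans; [now apply H|].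
apply Rle_lt_trans with ((Rabs L + 1) * Rabs (x' - x)).
- apply Rmult_le_compat_r; [apply Rabs_pos|]. pose proof (Rle_abs L). lra.
- apply (Rmult_lt_compat_l (Rabs L + 1)) in B2; [|lra].
  replace ((Rabs L + 1) * (eps / (Rabs L + 1))) with eps in B2 by (field; lra). easy.
Qed.

Lemma diff2_continuous_x (P : R -> R -> R) (x y px py : R) :
  diff2 P x y px py -> continuous (fun t => P t y) x.
Proof.
intros H. destruct (H 1 Rlt_0_1) as [d [Hd Hw]].
apply (lipschitz_continuous _ _ (1 + Rabs px) d Hd). intros x' Hx.
assert (Rabs (y - y) < d) as Hy by (rewrite Rminus_diag, Rabs_R0; easy).
specialize (Hw x' y Hx Hy). rewrite Rminus_diag, Rabs_R0 in Hw.
replace (P x' y - P x y)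
  with ((P x' y - P x y - px * (x' - x) - py * 0) + px * (x' - x)) by ring.
eapply Rle_trans; [apply Rabs_triang|]. rewrite (Rabs_mult px). lra.
Qed.

Lemma diff2_swap (P : R -> R -> R) (x y px py : R) :
  diff2 P x y px py -> diff2 (fun y x => P x y) y x py px.
Proof.
intros H eps He. destruct (H eps He) as [d [Hd Hw]]. exists d; split; [easy|].
intros y' x' Hy Hx. specialize (Hw x' y' Hx Hy).
replace (P x' y' - P x y - py * (y' - y) - px * (x' - x))
  with (P x' y' - P x y - px * (x' - x) - py * (y' - y)) by ring. lra.
Qed.

Lemma diff2_continuous_y (P : R -> R -> R) (x y px py : R) :
  diff2 P x y px py -> continuous (fun t => P x t) y.
Proof. intros H. now apply diff2_swap, diff2_continuous_x in H. Qed.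

Lemma nested_intervals (u v : nat -> R) :
  (forall n, u n <= u (S n)) -> (forall n, v (S n) <= v n) -> (forall n, u n <= v n) ->
  exists x, forall n, u n <= x <= v n.
Proof.
intros Hu Hv Huv.
assert (forall n m, u n <= v m) as A.
{ intros n m.
  assert (forall k, u n <= u (n + k)%nat) as A1.
  { induction k; [rewrite Nat.add_0_r; lra|]. rewrite Nat.add_succ_r. eapply Rle_trans; [apply IHk|apply Hu]. }
  assert (forall k, v (m + k)%nat <= v m) as A2.
  { induction k; [rewrite Nat.add_0_r; lra|]. rewrite Nat.add_succ_r. eapply Rle_trans; [apply Hv|apply IHk]. }
  eapply Rle_trans; [apply (A1 m)|]. eapply Rle_trans; [apply Huv|].
  rewrite Nat.add_comm. apply A2. }
destruct (completeness (fun x => exists n, x = u n)) as [x [Ub Lub]].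
- exists (v O). intros x [n ->]. apply A.
- now exists (u O), O.
- exists x. intros n. split; [apply Ub; now exists n|].
  apply Lub. intros y [m ->]. apply A.
Qed.

Section Goursat.
Variables (P Q : R -> R -> R) (a b c d : R).
Hypothesis hab : a <= b.
Hypothesis hcd : c <= d.
(** The shared [m] is the equality of cross derivatives, so [P dx + Q dy] is closed at each point.
    Since the derivatives may be discontinuous, Green's formula is out of reach and bisection takes
    its place. *)
Hypothesis closed : forall x y, a <= x <= b -> c <= y <= d ->
  exists px m qy, diff2 P x y px m /\ diff2 Q x y m qy.

Lemma ex_RInt_P (y x1 x2 : R) : c <= y <= d -> a <= x1 -> x1 <= x2 -> x2 <= b ->
  ex_RInt (fun x => P x y) x1 x2.
Proof.
intros. apply (ex_RInt_continuous (V := R_CompleteNormedModule)). intros z.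
rewrite Rmin_left, Rmax_right by easy. intros Hz.
destruct (closed z y) as [px [m [qy [HP _]]]]; [lra|easy|].
now apply (diff2_continuous_x _ _ _ px m).
Qed.

Lemma ex_RInt_Q (x y1 y2 : R) : a <= x <= b -> c <= y1 -> y1 <= y2 -> y2 <= d ->
  ex_RInt (fun y => Q x y) y1 y2.
Proof.
intros. apply (ex_RInt_continuous (V := R_CompleteNormedModule)). intros z.
rewrite Rmin_left, Rmax_right by easy. intros Hz.
destruct (closed x z) as [px [m [qy [_ HQ]]]]; [easy|lra|].
now apply (diff2_continuous_y _ _ _ m qy).
Qed.

Lemma rect_int_split_x (x1 x2 x3 y1 y2 : R) :
  a <= x1 -> x1 <= x2 -> x2 <= x3 -> x3 <= b -> c <= y1 -> y1 <= y2 -> y2 <= d ->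
  rect_int P Q x1 x3 y1 y2 = rect_int P Q x1 x2 y1 y2 + rect_int P Q x2 x3 y1 y2.
Proof.
intros. unfold rect_int.
assert (forall y, c <= y <= d ->
  RInt (fun x => P x y) x1 x3 = RInt (fun x => P x y) x1 x2 + RInt (fun x => P x y) x2 x3) as E.
{ intros. symmetry. apply (RInt_Chasles (V := R_CompleteNormedModule)); apply ex_RInt_P; lra. }
rewrite (E y1), (E y2) by lra. ring.
Qed.

Lemma rect_int_split_y (x1 x2 y1 y2 y3 : R) :
  a <= x1 -> x1 <= x2 -> x2 <= b -> c <= y1 -> y1 <= y2 -> y2 <= y3 -> y3 <= d ->
  rect_int P Q x1 x2 y1 y3 = rect_int P Q x1 x2 y1 y2 + rect_int P Q x1 x2 y2 y3.
Proof.
intros. unfold rect_int.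
assert (forall x, a <= x <= b ->
  RInt (fun y => Q x y) y1 y3 = RInt (fun y => Q x y) y1 y2 + RInt (fun y => Q x y) y2 y3) as E.
{ intros. symmetry. apply (RInt_Chasles (V := R_CompleteNormedModule)); apply ex_RInt_Q; lra. }
rewrite (E x1), (E x2) by lra. ring.
Qed.

Lemma RInt_diff_approx (f h : R -> R) (k e x1 x2 : R) : x1 <= x2 ->
  ex_RInt f x1 x2 -> ex_RInt h x1 x2 ->
  (forall t, x1 <= t <= x2 -> Rabs (f t - h t - k) <= e) ->
  Rabs (RInt f x1 x2 - RInt h x1 x2 - (x2 - x1) * k) <= (x2 - x1) * e.
Proof.
intros Hx Hf Hh H.
apply (norm_RInt_le_const (V := R_NormedModule) (fun t => f t - h t - k) x1 x2); [easy|easy|].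
apply (is_RInt_minus (V := R_NormedModule) (fun t => f t - h t) (fun _ => k)).
- apply (is_RInt_minus (V := R_NormedModule)); now apply (RInt_correct (V := R_CompleteNormedModule)).
- apply (is_RInt_const (V := R_NormedModule)).
Qed.

(* The first-order parts of [P] and [Q] at [(x, y)] contribute nothing, because
   the cross derivatives agree. *)
Lemma rect_int_small (x y : R) : a <= x <= b -> c <= y <= d ->
  forall eps, 0 < eps -> exists e, 0 < e /\
    forall x1 x2 y1 y2, a <= x1 -> x1 <= x <= x2 -> x2 <= b ->
      c <= y1 -> y1 <= y <= y2 -> y2 <= d -> x2 - x1 < e -> y2 - y1 < e ->
      Rabs (rect_int P Q x1 x2 y1 y2) <= 2 * eps * (x2 - x1 + (y2 - y1)) ^ 2.
Proof.
intros Hx Hy eps He. destruct (closed x y Hx Hy) as [px [m [qy [HP HQ]]]].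
destruct (HP eps He) as [e1 [P1 H1]]. destruct (HQ eps He) as [e2 [P2 H2]].
exists (Rmin e1 e2). split; [now apply Rmin_pos|].
intros x1 x2 y1 y2 B1 B2 B3 B4 B5 B6 Sx Sy.
pose proof (Rmin_l e1 e2). pose proof (Rmin_r e1 e2).
set (s := x2 - x1 + (y2 - y1)).
(* Up to the error, the horizontal sides contribute [(x2 - x1) * (m * (y1 - y2))]; the vertical
   sides, treated next, contribute exactly its opposite. *)
assert (Rabs (RInt (fun t => P t y1) x1 x2 - RInt (fun t => P t y2) x1 x2
  - (x2 - x1) * (m * (y1 - y2))) <= (x2 - x1) * (2 * eps * s)) as E1.
{ apply (RInt_diff_approx (fun t => P t y1) (fun t => P t y2)); try lra; try (apply ex_RInt_P; lra).
  intros t Ht.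
  assert (forall y', y1 <= y' <= y2 ->
    Rabs (P t y' - P x y - px * (t - x) - m * (y' - y)) <= eps * s) as B.
  { intros y' Hy'. eapply Rle_trans; [apply H1; apply Rabs_def1; lra|].
    apply Rmult_le_compat_l; [lra|]. unfold s.
    apply Rplus_le_compat; apply Rabs_le; lra. }
  replace (P t y1 - P t y2 - m * (y1 - y2))
    with ((P t y1 - P x y - px * (t - x) - m * (y1 - y))
          - (P t y2 - P x y - px * (t - x) - m * (y2 - y))) by ring.
  eapply Rle_trans; [apply Rabs_triang|]. rewrite Rabs_Ropp.
  generalize (B y1 ltac:(lra)) (B y2 ltac:(lra)). lra. }
assert (Rabs (RInt (fun t => Q x2 t) y1 y2 - RInt (fun t => Q x1 t) y1 y2
  - (y2 - y1) * (m * (x2 - x1))) <= (y2 - y1) * (2 * eps * s)) as E2.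
{ apply (RInt_diff_approx (fun t => Q x2 t) (fun t => Q x1 t)); try lra; try (apply ex_RInt_Q; lra).
  intros t Ht.
  assert (forall x', x1 <= x' <= x2 ->
    Rabs (Q x' t - Q x y - m * (x' - x) - qy * (t - y)) <= eps * s) as B.
  { intros x' Hx'. eapply Rle_trans; [apply H2; apply Rabs_def1; lra|].
    apply Rmult_le_compat_l; [lra|]. unfold s.
    apply Rplus_le_compat; apply Rabs_le; lra. }
  replace (Q x2 t - Q x1 t - m * (x2 - x1))
    with ((Q x2 t - Q x y - m * (x2 - x) - qy * (t - y))
          - (Q x1 t - Q x y - m * (x1 - x) - qy * (t - y))) by ring.
  eapply Rle_trans; [apply Rabs_triang|]. rewrite Rabs_Ropp.
  generalize (B x1 ltac:(lra)) (B x2 ltac:(lra)). lra. }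
unfold rect_int.
replace (2 * eps * s ^ 2) with ((x2 - x1) * (2 * eps * s) + (y2 - y1) * (2 * eps * s))
  by (unfold s; ring).
apply Rabs_le_between in E1, E2. apply Rabs_le. lra.
Qed.

(** If the boundary integral were at least [eps], one of the four quarters would carry at least
    [eps / 4], and so on. At the common point of the nested rectangles [rect_int_small] bounds the
    integral by an arbitrarily small multiple of the squared size, which also shrinks like
    [4^(-n)]. *)
Lemma goursat : rect_int P Q a b c d = 0.
Proof.
apply cond_eq. intros eps He. rewrite Rminus_0_r.
apply Rnot_le_lt. intros Hbad.
set (sx := fun n : nat => (b - a) / 2 ^ n). set (sy := fun n : nat => (d - c) / 2 ^ n).
assert (forall n : nat, 0 < 2 ^ n) as P2n by (intros; apply pow_lt; lra).
assert (forall n, 0 <= sx n) as Psx by (intros; apply Rdiv_le_0_compat; [lra|easy]).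
assert (forall n, 0 <= sy n) as Psy by (intros; apply Rdiv_le_0_compat; [lra|easy]).
assert (forall n, sx n = 2 * sx (S n)) as Hsx.
{ intros n. unfold sx. simpl. field. apply Rgt_not_eq, P2n. }
assert (forall n, sy n = 2 * sy (S n)) as Hsy.
{ intros n. unfold sy. simpl. field. apply Rgt_not_eq, P2n. }
(* Side lengths are determined by the stage [n], so a rectangle is encoded by its lower left
   corner. *)
set (bad := fun n (z : R * R) =>
  a <= fst z /\ fst z + sx n <= b /\ c <= snd z /\ snd z + sy n <= d /\
  eps / 4 ^ n <= Rabs (rect_int P Q (fst z) (fst z + sx n) (snd z) (snd z + sy n))).
assert (forall n z, bad n z -> exists z', bad (S n) z' /\
  fst z <= fst z' /\ fst z' + sx (S n) <= fst z + sx n /\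
  snd z <= snd z' /\ snd z' + sy (S n) <= snd z + sy n) as Step.
{ intros n [x y] [B1 [B2 [B3 [B4 B5]]]]. simpl in *.
  pose proof (Psx (S n)) as Px. pose proof (Psy (S n)) as Py.
  rewrite (Hsx n) in *. rewrite (Hsy n) in *.
  set (wx := sx (S n)) in *. set (wy := sy (S n)) in *.
  assert (eps / 4 ^ n = 4 * (eps / 4 ^ S n)) as E4.
  { simpl. field. apply Rgt_not_eq, pow_lt; lra. }
  apply NNPP. intros N.
  assert (forall x' y', (x' = x \/ x' = x + wx) -> (y' = y \/ y' = y + wy) ->
    Rabs (rect_int P Q x' (x' + wx) y' (y' + wy)) < eps / 4 ^ S n) as G.
  { intros x' y' Hx' Hy'. apply Rnot_le_lt. intros G. apply N. exists (x', y').
    unfold bad; simpl fst; simpl snd; fold wx; fold wy.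
    destruct Hx' as [-> | ->], Hy' as [-> | ->]; repeat split; try lra; exact G. }
  rewrite (rect_int_split_x x (x + wx)) in B5 by lra.
  rewrite (rect_int_split_y x _ y (y + wy)) in B5 by lra.
  rewrite (rect_int_split_y (x + wx) _ y (y + wy)) in B5 by lra.
  pose proof (G x y ltac:(auto) ltac:(auto)) as G1.
  pose proof (G x (y + wy) ltac:(auto) ltac:(auto)) as G2.
  pose proof (G (x + wx) y ltac:(auto) ltac:(auto)) as G3.
  pose proof (G (x + wx) (y + wy) ltac:(auto) ltac:(auto)) as G4.
  replace (x + wx + wx) with (x + 2 * wx) in * by ring.
  replace (y + wy + wy) with (y + 2 * wy) in * by ring.
  apply Rabs_def2 in G1, G2, G3, G4. revert B5. apply Rlt_not_le. apply Rabs_def1; lra. }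
assert (bad O (a, c)) as B0.
{ unfold bad, sx, sy; simpl. repeat split; try lra.
  replace (a + (b - a) / 1) with b by field. replace (c + (d - c) / 1) with d by field. lra. }
(* The proof of badness travels with the corner, so that choice can be applied to [Step] at every
   stage. *)
set (nxt := fun n (z : {z | bad n z}) =>
  let w := constructive_indefinite_description _ (Step n (proj1_sig z) (proj2_sig z)) in
  exist (bad (S n)) (proj1_sig w) (proj1 (proj2_sig w))).
set (sq := nat_rect (fun n => {z | bad n z}) (exist _ (a, c) B0) nxt).
assert (forall n, let z := proj1_sig (sq n) in let z' := proj1_sig (sq (S n)) in
  fst z <= fst z' /\ fst z' + sx (S n) <= fst z + sx n /\
  snd z <= snd z' /\ snd z' + sy (S n) <= snd z + sy n) as Nest.
{ intros n z z'. unfold z, z'. change (sq (S n)) with (nxt n (sq n)). unfold nxt. cbn [proj1_sig].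
  destruct (constructive_indefinite_description _ _) as [w [W1 W2]]. exact W2. }
assert (forall n, bad n (proj1_sig (sq n))) as Bad by (intros n; apply (proj2_sig (sq n))).
destruct (nested_intervals (fun n => fst (proj1_sig (sq n)))
  (fun n => fst (proj1_sig (sq n)) + sx n)) as [x Hx].
{ intros n; apply (Nest n). } { intros n; apply (Nest n). } { intros n. generalize (Psx n). lra. }
destruct (nested_intervals (fun n => snd (proj1_sig (sq n)))
  (fun n => snd (proj1_sig (sq n)) + sy n)) as [y Hy].
{ intros n; apply (Nest n). } { intros n; apply (Nest n). } { intros n. generalize (Psy n). lra. }
set (S2 := (b - a + (d - c)) ^ 2).
assert (0 <= S2) as PS2 by apply pow2_ge_0.
(* The factor 2 and [S2] come from [rect_int_small]; the added 1 makes the final contradiction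
   strict and covers degenerate rectangles. *)
destruct (rect_int_small x y) with (eps := eps / (2 * S2 + 1)) as [e [Pe He']].
{ destruct (Bad O) as [T1 [T2 _]]. specialize (Hx O). lra. }
{ destruct (Bad O) as [_ [_ [T1 [T2 _]]]]. specialize (Hy O). lra. }
{ apply Rdiv_lt_0_compat; lra. }
destruct (pow_lt_1_zero (/ 2)) with (y := e / (b - a + (d - c) + 1)) as [N HN].
{ rewrite Rabs_pos_eq; lra. }
{ apply Rdiv_lt_0_compat; lra. }
specialize (HN N (le_n _)).
rewrite Rabs_pos_eq in HN by (apply pow_le; lra).
assert ((b - a + (d - c) + 1) * (/ 2) ^ N < e) as HN'.
{ apply (Rmult_lt_compat_l (b - a + (d - c) + 1)) in HN; [|lra].
  replace ((b - a + (d - c) + 1) * (e / (b - a + (d - c) + 1))) with e in HN by (field; lra). easy. }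
assert (0 < (/ 2) ^ N) as PhN by (apply pow_lt; lra).
assert (sx N = (b - a) * (/ 2) ^ N) as EsN by (unfold sx; now rewrite pow_inv).
assert (sy N = (d - c) * (/ 2) ^ N) as EtN by (unfold sy; now rewrite pow_inv).
assert (0 <= (b - a) * (/ 2) ^ N) as Q1 by (apply Rmult_le_pos; lra).
assert (0 <= (d - c) * (/ 2) ^ N) as Q2 by (apply Rmult_le_pos; lra).
specialize (Hx N). specialize (Hy N). simpl in Hx, Hy.
destruct (Bad N) as [T1 [T2 [T3 [T4 T5]]]].
set (xn := fst (proj1_sig (sq N))) in *. set (yn := snd (proj1_sig (sq N))) in *.
assert (Rabs (rect_int P Q xn (xn + sx N) yn (yn + sy N))
  <= 2 * (eps / (2 * S2 + 1)) * (xn + sx N - xn + (yn + sy N - yn)) ^ 2) as K.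
{ apply He'; try lra. }
replace (xn + sx N - xn + (yn + sy N - yn)) with ((b - a + (d - c)) * (/ 2) ^ N) in K
  by (rewrite EsN, EtN; ring).
rewrite Rpow_mult_distr in K. fold S2 in K.
assert (((/ 2) ^ N) ^ 2 = / 4 ^ N) as E4.
{ rewrite <- pow_inv, <- pow_mult, Nat.mul_comm, pow_mult. f_equal. field. }
rewrite E4 in K.
assert (0 < / 4 ^ N) as P4 by (apply Rinv_0_lt_compat, pow_lt; lra).
assert (2 * (eps / (2 * S2 + 1)) * (S2 * / 4 ^ N) < eps / 4 ^ N) as K2.
{ replace (2 * (eps / (2 * S2 + 1)) * (S2 * / 4 ^ N))
    with (eps * / 4 ^ N * (1 - / (2 * S2 + 1))) by (field; split; [apply Rgt_not_eq, pow_lt|]; lra).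
  assert (0 < / (2 * S2 + 1)) by (apply Rinv_0_lt_compat; lra).
  assert (0 < eps * / 4 ^ N) by now apply Rmult_lt_0_compat.
  unfold Rdiv. nra. }
lra.
Qed.
End Goursat.

(** * Circle means *)

Lemma Cmod_le_abs (z : C) : Cmod z <= Rabs (fst z) + Rabs (snd z).
Proof.
destruct z as [x y]. simpl.
replace (x, y) with (RtoC x + Ci * RtoC y)%C
  by (unfold RtoC, Ci, Cplus, Cmult; simpl; f_equal; ring).
eapply Rle_trans; [apply Cmod_triangle|].
rewrite Cmod_mult, Cmod_Ci, 2!Cmod_R. lra.
Qed.

Lemma fst_le_Cmod (z : C) : Rabs (fst z) <= Cmod z.
Proof. eapply Rle_trans; [apply Rmax_l|apply Rmax_Cmod]. Qed.

Lemma snd_le_Cmod (z : C) : Rabs (snd z) <= Cmod z.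
Proof. eapply Rle_trans; [apply Rmax_r|apply Rmax_Cmod]. Qed.

(** * The complex exponential and the Cauchy-Riemann equations *)

Definition cexp (w : C) : C := (exp (fst w) * cos (snd w), exp (fst w) * sin (snd w)).

Lemma cexp_plus (a b : C) : cexp (a + b) = (cexp a * cexp b)%C.
Proof.
unfold cexp, Cplus, Cmult. simpl. rewrite exp_plus, cos_plus, sin_plus. f_equal; ring.
Qed.

Lemma derivable_at_0 (f : R -> R) (l : R) : derivable_pt_lim f 0 l ->
  forall eps, 0 < eps -> exists d, 0 < d /\
    forall h, Rabs h < d -> Rabs (f h - f 0 - l * h) <= eps * Rabs h.
Proof.
intros H eps He. destruct (H eps He) as [d Hd]. exists d; split; [apply cond_pos|].
intros h Hh. destruct (Req_dec h 0) as [-> |Nh].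
- rewrite Rmult_0_r, Rminus_0_r, Rminus_diag, Rabs_R0. lra.
- specialize (Hd h Nh Hh). rewrite Rplus_0_l in Hd.
  replace (f h - f 0 - l * h) with (((f h - f 0) / h - l) * h) by (field; easy).
  rewrite Rabs_mult. apply Rmult_le_compat_r; [apply Rabs_pos|lra].
Qed.

Lemma cexp_at_0 (eps : R) : 0 < eps -> exists d, 0 < d /\
  forall h, Cmod h < d -> Cmod (cexp h - 1 - h) <= eps * Cmod h.
Proof.
(* Each coordinate of the remainder will be at most [3 * e * m], so [6 * e <= eps] is enough;
   [e <= 1] serves to keep [exp x <= 2]. *)
intros He. set (e := Rmin 1 (eps / 8)).
assert (0 < e) as Pe by (apply Rmin_pos; lra).
pose proof (Rmin_l 1 (eps / 8)) as Le1. pose proof (Rmin_r 1 (eps / 8)) as Le2. fold e in Le1, Le2.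
destruct (derivable_at_0 exp 1) with (eps := e) as [d1 [P1 H1]]; [|easy|].
{ generalize (derivable_pt_lim_exp 0). now rewrite exp_0. }
destruct (derivable_at_0 cos 0) with (eps := e) as [d2 [P2 H2]]; [|easy|].
{ generalize (derivable_pt_lim_cos 0). now rewrite sin_0, Ropp_0. }
destruct (derivable_at_0 sin 1) with (eps := e) as [d3 [P3 H3]]; [|easy|].
{ generalize (derivable_pt_lim_sin 0). now rewrite cos_0. }
exists (Rmin (Rmin (e / 2) d1) (Rmin d2 d3)). split.
{ repeat apply Rmin_pos; lra. }
intros [x y] Hh.
pose proof (fst_le_Cmod (x, y)) as Bx. pose proof (snd_le_Cmod (x, y)) as By. simpl in Bx, By.
set (m := Cmod (x, y)) in *.
assert (m < Rmin (e / 2) d1) as G1 by (eapply Rlt_le_trans; [apply Hh|apply Rmin_l]).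
assert (m < Rmin d2 d3) as G2 by (eapply Rlt_le_trans; [apply Hh|apply Rmin_r]).
pose proof (Rmin_l (e / 2) d1). pose proof (Rmin_r (e / 2) d1).
pose proof (Rmin_l d2 d3). pose proof (Rmin_r d2 d3).
specialize (H1 x ltac:(lra)). specialize (H2 y ltac:(lra)). specialize (H3 y ltac:(lra)).
rewrite exp_0, Rmult_1_l in H1. rewrite cos_0, Rmult_0_l, Rminus_0_r in H2.
rewrite sin_0, Rminus_0_r, Rmult_1_l in H3.
pose proof (Rabs_pos x). pose proof (Rabs_pos y).
assert (Rabs (exp x - 1) <= e) as E1.
{ replace (exp x - 1) with ((exp x - 1 - x) + x) by ring.
  eapply Rle_trans; [apply Rabs_triang|].
  assert (e * Rabs x <= 1 * Rabs x) by (apply Rmult_le_compat_r; lra). lra. }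
assert (0 < exp x <= 2) as E2.
{ split; [apply exp_pos|]. apply Rabs_le_between in E1. lra. }
eapply Rle_trans; [apply Cmod_le_abs|]. unfold cexp. simpl.
replace (exp x * cos y + -(1) + - x) with ((exp x - 1 - x) + exp x * (cos y - 1)) by ring.
replace (exp x * sin y + - 0 + - y) with (exp x * (sin y - y) + (exp x - 1) * y) by ring.
assert (Rabs (exp x - 1 - x + exp x * (cos y - 1)) <= 3 * e * m) as F1.
{ eapply Rle_trans; [apply Rabs_triang|]. rewrite Rabs_mult, (Rabs_pos_eq (exp x)) by lra.
  assert (exp x * Rabs (cos y - 1) <= 2 * (e * Rabs y)).
  { apply Rmult_le_compat; try lra. apply Rabs_pos. }
  assert (e * Rabs x <= e * m) by (apply Rmult_le_compat_l; lra).
  assert (e * Rabs y <= e * m) by (apply Rmult_le_compat_l; lra). lra. }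
assert (Rabs (exp x * (sin y - y) + (exp x - 1) * y) <= 3 * e * m) as F2.
{ eapply Rle_trans; [apply Rabs_triang|]. rewrite 2!Rabs_mult, (Rabs_pos_eq (exp x)) by lra.
  assert (exp x * Rabs (sin y - y) <= 2 * (e * Rabs y)).
  { apply Rmult_le_compat; try lra. apply Rabs_pos. }
  assert (Rabs (exp x - 1) * Rabs y <= e * Rabs y) by (apply Rmult_le_compat_r; lra).
  assert (e * Rabs y <= e * m) by (apply Rmult_le_compat_l; lra). lra. }
assert (0 <= m) by apply Cmod_ge_0.
assert (e * m <= eps / 8 * m) by (apply Rmult_le_compat_r; lra). assert (0 <= eps * m) by (apply Rmult_le_pos; lra). lra.
Qed.

Lemma cderiv_cexp (z : C) : cderiv cexp z (cexp z).
Proof.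
intros eps He. pose proof (Cmod_ge_0 (cexp z)) as P.
destruct (cexp_at_0 (eps / (Cmod (cexp z) + 1))) as [d [Hd H]].
{ apply Rdiv_lt_0_compat; lra. }
exists d; split; [easy|]. intros w Hw. specialize (H (w - z)%C Hw).
replace (cexp w - cexp z - cexp z * (w - z))%C with (cexp z * (cexp (w - z) - 1 - (w - z)))%C.
2:{ replace (cexp w) with (cexp z * cexp (w - z))%C; [ring|].
  rewrite <- cexp_plus. f_equal. ring. }
rewrite Cmod_mult.
apply Rle_trans with ((Cmod (cexp z) + 1) * (eps / (Cmod (cexp z) + 1) * Cmod (w - z))).
- apply Rmult_le_compat; auto using Cmod_ge_0. lra.
- right. field. lra.
Qed.

(** The Cauchy-Riemann equations are visible in the repeated entries: [fst l] is both the
    [y]-derivative of the imaginary part and the [x]-derivative of the real part. *)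
Lemma cderiv_diff2 (h : C -> C) (x y : R) (l : C) : cderiv h (x, y) l ->
  diff2 (fun x y => fst (h (x, y))) x y (fst l) (- snd l) /\
  diff2 (fun x y => snd (h (x, y))) x y (snd l) (fst l).
Proof.
intros H. split; intros eps He; destruct (H (eps) He) as [d [Hd Hw]];
  exists (d / 2); (split; [lra|]); intros x' y' Hx Hy;
  pose proof (Cmod_le_abs ((x', y') - (x, y))%C) as T; simpl in T;
  change (x' + - x) with (x' - x) in T; change (y' + - y) with (y' - y) in T;
  (assert (Cmod ((x', y') - (x, y))%C < d) as B by lra);
  specialize (Hw _ B).
- pose proof (fst_le_Cmod (h (x', y') - h (x, y) - l * ((x', y') - (x, y)))%C) as F.
  simpl in F.
  replace (fst (h (x', y')) - fst (h (x, y)) - fst l * (x' - x) - - snd l * (y' - y))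
    with (fst (h (x', y')) + - fst (h (x, y)) + - (fst l * (x' + - x) - snd l * (y' + - y))) by ring.
  eapply Rle_trans; [apply F|]. eapply Rle_trans; [apply Hw|].
  apply Rmult_le_compat_l; lra.
- pose proof (snd_le_Cmod (h (x', y') - h (x, y) - l * ((x', y') - (x, y)))%C) as F.
  simpl in F.
  replace (snd (h (x', y')) - snd (h (x, y)) - snd l * (x' - x) - fst l * (y' - y))
    with (snd (h (x', y')) + - snd (h (x, y)) + - (fst l * (y' + - y) + snd l * (x' + - x))) by ring.
  eapply Rle_trans; [apply F|]. eapply Rle_trans; [apply Hw|].
  apply Rmult_le_compat_l; lra.
Qed.

Lemma Cmod_circle_point (r t : R) : Cmod (circle_point r t) = Rabs r.
Proof.
unfold circle_point, Cmod. cbn [fst snd]. rewrite <- sqrt_Rsqr_abs. f_equal.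
unfold Rsqr. replace (r * r) with (r * r * (Rsqr (sin t) + Rsqr (cos t))) by (rewrite sin2_cos2; ring).
unfold Rsqr. ring.
Qed.

Lemma circle_point_2PI (r : R) : circle_point r (2 * PI) = circle_point r 0.
Proof. unfold circle_point. now rewrite cos_2PI, sin_2PI, cos_0, sin_0. Qed.

(* In the coordinate [log z] the annulus becomes a rectangle, and the two
   radial sides of the boundary integral cancel by periodicity. *)
Lemma annulus_mean_fst (H : C -> C) (r1 r2 : R) : 0 < r1 -> r1 <= r2 ->
  (forall z, r1 <= Cmod z <= r2 -> exists l, cderiv H z l) ->
  RInt (fun t => fst (H (circle_point r1 t))) 0 (2 * PI)
  = RInt (fun t => fst (H (circle_point r2 t))) 0 (2 * PI).
Proof.
intros P1 P12 D.
(* With [u + i v] the composite of [H] and the exponential, this is the form [v dx + u dy], the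
   imaginary part of [(u + i v) (dx + i dy)]. On vertical sides it integrates the real part of [H]
   over circles. *)
pose proof (goursat (fun x y => snd (H (circle_point (exp x) y)))
  (fun x y => fst (H (circle_point (exp x) y))) (ln r1) (ln r2) 0 (2 * PI)) as G.
unfold rect_int in G.
rewrite (RInt_ext _ (fun x => snd (H (circle_point (exp x) (2 * PI))))) in G
  by (intros; now rewrite circle_point_2PI).
rewrite 2!exp_ln in G by lra.
enough (forall a b c : R, a - a + b - c = 0 -> c = b) as A.
{ eapply A, G.
  - destruct (Rle_lt_or_eq_dec r1 r2 P12) as [L| ->]; [left; now apply ln_increasing|lra].
  - generalize PI_RGT_0. lra.
  - intros x y [Hx1 Hx2] Hy.
    destruct (D (cexp (x, y))) as [l Hl].
    { change (cexp (x, y)) with (circle_point (exp x) y).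
      rewrite Cmod_circle_point, Rabs_pos_eq by (left; apply exp_pos).
      assert (forall u v, u <= v -> exp u <= exp v) as M.
      { intros u v [L| ->]; [left; now apply exp_increasing|lra]. }
      apply M in Hx1, Hx2. rewrite exp_ln in Hx1, Hx2 by lra. lra. }
    destruct (cderiv_diff2 (fun w => H (cexp w)) x y (l * cexp (x, y))) as [D1 D2].
    { apply cderiv_comp; [apply cderiv_cexp|easy]. }
    do 3 eexists. split; [apply D2|apply D1]. }
intros; lra.
Qed.

(** * Complex integrals over circles *)

Definition cint (f : R -> C) : C :=
  (RInt (fun t => fst (f t)) 0 (2 * PI), RInt (fun t => snd (f t)) 0 (2 * PI)).

Definition circ_int (r : R) (H : C -> C) : C := cint (fun t => H (circle_point r t)).

Lemma fst_mult_neg_Ci (z : C) : fst (- Ci * z)%C = snd z.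
Proof. destruct z; simpl. ring. Qed.

(** The imaginary part follows from the real part for [- Ci * H], which is differentiable wherever
    [H] is. *)
Lemma annulus_circ_int (H : C -> C) (r1 r2 : R) : 0 < r1 -> r1 <= r2 ->
  (forall z, r1 <= Cmod z <= r2 -> exists l, cderiv H z l) ->
  circ_int r1 H = circ_int r2 H.
Proof.
intros P1 P12 D. unfold circ_int, cint. f_equal.
- now apply annulus_mean_fst.
- assert (forall r, RInt (fun t => snd (H (circle_point r t))) 0 (2 * PI)
    = RInt (fun t => fst (- Ci * H (circle_point r t))%C) 0 (2 * PI)) as E.
  { intros r. apply RInt_ext. intros. now rewrite fst_mult_neg_Ci. }
  rewrite 2!E.
  apply (annulus_mean_fst (fun z => - Ci * H z)%C); auto.
  intros z Hz. destruct (D z Hz) as [l Hl]. exists (- Ci * l)%C. now apply cderiv_scal.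
Qed.

Lemma cos_lipschitz (a b : R) : Rabs (cos a - cos b) <= Rabs (a - b).
Proof.
rewrite <- (Rmult_1_l (Rabs (a - b))).
apply (bounded_variation cos (fun t => - sin t) 1 b a). intros t _.
split; [apply is_derive_cos|]. rewrite Rabs_Ropp.
apply Rabs_le, SIN_bound.
Qed.

Lemma sin_lipschitz (a b : R) : Rabs (sin a - sin b) <= Rabs (a - b).
Proof.
rewrite <- (Rmult_1_l (Rabs (a - b))).
apply (bounded_variation sin cos 1 b a). intros t _. split; [apply is_derive_sin|].
apply Rabs_le, COS_bound.
Qed.

Lemma circle_point_dist (r r' t t' : R) :
  Cmod (circle_point r' t' - circle_point r t) <= Rabs (r' - r) + 2 * Rabs r * Rabs (t' - t).
Proof.
eapply Rle_trans; [apply (Cmod_triangle_sub _ (circle_point r t'))|].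
apply Rplus_le_compat.
- replace (circle_point r' t' - circle_point r t')%C with (circle_point (r' - r) t')
    by (unfold circle_point, Cminus, Cplus, Copp; simpl; f_equal; ring).
  rewrite Cmod_circle_point. lra.
- eapply Rle_trans; [apply Cmod_le_abs|]. simpl.
  replace (r * cos t' + - (r * cos t)) with (r * (cos t' - cos t)) by ring.
  replace (r * sin t' + - (r * sin t)) with (r * (sin t' - sin t)) by ring.
  rewrite 2!Rabs_mult.
  generalize (Rmult_le_compat_l _ _ _ (Rabs_pos r) (cos_lipschitz t' t))
    (Rmult_le_compat_l _ _ _ (Rabs_pos r) (sin_lipschitz t' t)). lra.
Qed.

Lemma ccont_circle_point (H : C -> C) (r t : R) : ccont H (circle_point r t) ->
  forall eps, 0 < eps -> exists d, 0 < d /\ forall r' t',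
    Rabs (r' - r) < d -> Rabs (t' - t) < d ->
    Cmod (H (circle_point r' t') - H (circle_point r t)) < eps.
Proof.
intros HC eps He. destruct (HC eps He) as [d [Hd Hw]].
pose proof (Rabs_pos r) as Pr.
exists (d / (1 + 2 * Rabs r)). split; [apply Rdiv_lt_0_compat; lra|].
intros r' t' Hr Ht. apply Hw.
eapply Rle_lt_trans; [apply circle_point_dist|].
replace d with (d / (1 + 2 * Rabs r) + 2 * Rabs r * (d / (1 + 2 * Rabs r))) by (field; lra).
apply Rplus_lt_le_compat; [easy|]. apply Rmult_le_compat_l; lra.
Qed.

Definition pcont (f : R -> C) : Prop :=
  forall t eps, 0 < eps -> exists d, 0 < d /\ forall t', Rabs (t' - t) < d ->
    Cmod (f t' - f t) < eps.

Lemma pcont_plus (u v : R -> C) : pcont u -> pcont v -> pcont (fun t => u t + v t)%C.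
Proof.
intros Hu Hv t eps He.
destruct (Hu t (eps / 2)) as [d1 [D1 W1]]; [lra|].
destruct (Hv t (eps / 2)) as [d2 [D2 W2]]; [lra|].
exists (Rmin d1 d2). split; [now apply Rmin_pos|]. intros t' Ht.
specialize (W1 t' (Rlt_le_trans _ _ _ Ht (Rmin_l _ _))).
specialize (W2 t' (Rlt_le_trans _ _ _ Ht (Rmin_r _ _))).
replace (u t' + v t' - (u t + v t))%C with ((u t' - u t) + (v t' - v t))%C by ring.
eapply Rle_lt_trans; [apply Cmod_triangle|]. lra.
Qed.

Lemma pcont_scal (c : C) (u : R -> C) : pcont u -> pcont (fun t => c * u t)%C.
Proof.
intros Hu t eps He. pose proof (Cmod_ge_0 c) as Pc.
destruct (Hu t (eps / (Cmod c + 1))) as [d [Hd Hw]].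
{ apply Rdiv_lt_0_compat; lra. }
exists d; split; [easy|]. intros t' Ht. specialize (Hw t' Ht).
replace (c * u t' - c * u t)%C with (c * (u t' - u t))%C by ring. rewrite Cmod_mult.
apply (Rmult_lt_compat_l (Cmod c + 1)) in Hw; [|lra].
replace ((Cmod c + 1) * (eps / (Cmod c + 1))) with eps in Hw by (field; lra).
generalize (Cmod_ge_0 (u t' - u t)). lra.
Qed.

Lemma pcont_circle (H : C -> C) (r : R) :
  (forall t, ccont H (circle_point r t)) -> pcont (fun t => H (circle_point r t)).
Proof.
intros HC t eps He. destruct (ccont_circle_point H r t (HC t) eps He) as [d [Hd Hw]].
exists d; split; [easy|]. intros t' Ht. apply Hw; [|easy]. now rewrite Rminus_diag, Rabs_R0.
Qed.

Lemma eps_continuous (f : R -> R) (t : R) :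
  (forall eps, 0 < eps -> exists d, 0 < d /\ forall t', Rabs (t' - t) < d -> Rabs (f t' - f t) < eps) ->
  continuous f t.
Proof.
intros H. apply continuity_pt_filterlim. intros eps He.
destruct (H eps He) as [d [Hd Hw]]. exists d; split; [easy|]. intros t' [_ Ht]. now apply Hw.
Qed.

Lemma pcont_fst (f : R -> C) (t : R) : pcont f -> continuous (fun t => fst (f t)) t.
Proof.
intros H. apply eps_continuous. intros eps He. destruct (H t eps He) as [d [Hd Hw]].
exists d; split; [easy|]. intros t' Ht. eapply Rle_lt_trans; [|now apply (Hw t')].
apply (fst_le_Cmod (f t' - f t)%C).
Qed.

Lemma pcont_snd (f : R -> C) (t : R) : pcont f -> continuous (fun t => snd (f t)) t.
Proof.
intros H. apply eps_continuous. intros eps He. destruct (H t eps He) as [d [Hd Hw]].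
exists d; split; [easy|]. intros t' Ht. eapply Rle_lt_trans; [|now apply (Hw t')].
apply (snd_le_Cmod (f t' - f t)%C).
Qed.

Lemma pcont_Cmod (f : R -> C) (t : R) : pcont f -> continuous (fun t => Cmod (f t)) t.
Proof.
intros H. apply eps_continuous. intros eps He. destruct (H t eps He) as [d [Hd Hw]].
exists d; split; [easy|]. intros t' Ht. eapply Rle_lt_trans; [|now apply (Hw t')].
pose proof (Cmod_le_sub (f t') (f t)). pose proof (Cmod_le_sub (f t) (f t')) as T.
rewrite (Cmod_minus_sym (f t)) in T. apply Rabs_le. lra.
Qed.

Lemma is_RInt_fst (f : R -> C) (a b : R) : pcont f ->
  is_RInt (fun t => fst (f t)) a b (RInt (fun t => fst (f t)) a b).
Proof.
intros H. apply (RInt_correct (V := R_CompleteNormedModule)).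
apply (ex_RInt_continuous (V := R_CompleteNormedModule)). intros; now apply pcont_fst.
Qed.

Lemma is_RInt_snd (f : R -> C) (a b : R) : pcont f ->
  is_RInt (fun t => snd (f t)) a b (RInt (fun t => snd (f t)) a b).
Proof.
intros H. apply (RInt_correct (V := R_CompleteNormedModule)).
apply (ex_RInt_continuous (V := R_CompleteNormedModule)). intros; now apply pcont_snd.
Qed.

Lemma cint_ext (f h : R -> C) : (forall t, f t = h t) -> cint f = cint h.
Proof. intros E. unfold cint. f_equal; apply RInt_ext; intros; now rewrite E. Qed.

Lemma cint_plus (f h : R -> C) : pcont f -> pcont h ->
  cint (fun t => f t + h t)%C = (cint f + cint h)%C.
Proof.
intros Hf Hh. unfold cint, Cplus. cbn [fst snd]. f_equal.
- apply is_RInt_unique. apply (is_RInt_plus (V := R_NormedModule)); now apply is_RInt_fst.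
- apply is_RInt_unique. apply (is_RInt_plus (V := R_NormedModule)); now apply is_RInt_snd.
Qed.

Lemma cint_scal (c : C) (f : R -> C) : pcont f ->
  cint (fun t => c * f t)%C = (c * cint f)%C.
Proof.
intros Hf. unfold cint, Cmult. cbn [fst snd]. f_equal.
- apply is_RInt_unique. apply (is_RInt_minus (V := R_NormedModule));
  apply (is_RInt_scal (V := R_NormedModule)); [now apply is_RInt_fst|now apply is_RInt_snd].
- apply is_RInt_unique. apply (is_RInt_plus (V := R_NormedModule));
  apply (is_RInt_scal (V := R_NormedModule)); [now apply is_RInt_snd|now apply is_RInt_fst].
Qed.

(** The pair of real integrals is also the integral in [C_R_NormedModule], whose norm is [Cmod];
    this avoids the constant lost by estimating each coordinate. *)
Lemma cint_norm_le (f : R -> C) (b : R -> R) : pcont f ->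
  (forall t, continuous b t) -> (forall t, 0 <= t <= 2 * PI -> Cmod (f t) <= b t) ->
  Cmod (cint f) <= RInt b 0 (2 * PI).
Proof.
intros Hf Hb H. rewrite Cmod_norm.
apply (norm_RInt_le (V := C_R_NormedModule) f b 0 (2 * PI)).
- generalize PI_RGT_0; lra.
- intros t Ht. specialize (H t Ht). rewrite Cmod_norm in H. exact H.
- apply is_RInt_fct_extend_pair; [now apply is_RInt_fst|now apply is_RInt_snd].
- apply (RInt_correct (V := R_CompleteNormedModule)).
  apply (ex_RInt_continuous (V := R_CompleteNormedModule)). intros; apply Hb.
Qed.

Lemma cint_norm_le_const (f : R -> C) (M : R) : pcont f ->
  (forall t, 0 <= t <= 2 * PI -> Cmod (f t) <= M) -> Cmod (cint f) <= 2 * PI * M.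
Proof.
intros Hf H. eapply Rle_trans; [apply (cint_norm_le f (fun _ => M)); auto|].
- intros; apply continuous_const.
- rewrite RInt_const. right. change (scal (2 * PI - 0) M) with ((2 * PI - 0) * M). ring.
Qed.

Lemma pcont_const (c : C) : pcont (fun _ => c).
Proof.
intros t eps He. exists 1; split; [lra|]. intros.
replace (c - c)%C with (RtoC 0) by ring. now rewrite Cmod_0.
Qed.

Lemma cint_const (c : C) : cint (fun _ => c) = (RtoC (2 * PI) * c)%C.
Proof.
unfold cint, Cmult. simpl. rewrite 2!RInt_const.
change (scal (2 * PI - 0) (fst c)) with ((2 * PI - 0) * fst c).
change (scal (2 * PI - 0) (snd c)) with ((2 * PI - 0) * snd c). f_equal; ring.
Qed.

(** Uniform continuity of [H] in polar coordinates on a compact rectangle. Radius 0 is included, so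
    that circles can be shrunk to the centre. *)
Lemma circ_int_close (H : C -> C) (r0 : R) :
  (forall z, Cmod z <= r0 -> ccont H z) ->
  forall eps, 0 < eps -> exists d, 0 < d /\ forall r r', 0 <= r <= r0 -> 0 <= r' <= r0 ->
    Rabs (r' - r) < d -> Cmod (circ_int r' H - circ_int r H) <= eps.
Proof.
intros HC eps He. set (e := eps / (4 * (2 * PI))).
pose proof PI_RGT_0 as Ppi.
assert (0 < e) as Pe by (apply Rdiv_lt_0_compat; lra).
assert (forall r t, 0 <= r <= r0 -> ccont H (circle_point r t)) as HC'.
{ intros r t Hr. apply HC. rewrite Cmod_circle_point, Rabs_pos_eq; lra. }
assert (forall q : C -> R, (forall z w, Rabs (q z - q w) <= Cmod (z - w)) ->
  exists d : posreal, forall x y u v, 0 <= x <= r0 -> 0 <= y <= 2 * PI -> 0 <= u <= r0 ->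
    0 <= v <= 2 * PI -> Rabs (u - x) < d -> Rabs (v - y) < d ->
    Rabs (q (H (circle_point u v)) - q (H (circle_point x y))) < e) as U.
{ intros q Hq.
  apply (uniform_continuity_2d (fun x y => q (H (circle_point x y))) 0 r0 0 (2 * PI)) with (eps := mkposreal e Pe).
  intros x y Hx Hy [e' Pe'].
  destruct (ccont_circle_point H x y (HC' x y Hx) e' Pe') as [d [Hd Hw]].
  exists (mkposreal d Hd). intros u v Hu Hv. simpl in *.
  eapply Rle_lt_trans; [apply Hq|]. now apply Hw. }
destruct (U fst) as [d1 H1].
{ intros z w. apply (fst_le_Cmod (z - w)%C). }
destruct (U snd) as [d2 H2].
{ intros z w. apply (snd_le_Cmod (z - w)%C). }
exists (Rmin d1 d2). split; [apply Rmin_pos; apply cond_pos|].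
intros r r' Hr Hr' B.
pose proof (Rmin_l d1 d2). pose proof (Rmin_r d1 d2).
assert (forall s, 0 <= s <= r0 -> pcont (fun t => H (circle_point s t))) as PC.
{ intros s Hs. apply pcont_circle. auto. }
eapply Rle_trans; [apply Cmod_le_abs|].
replace eps with (2 * (2 * PI * e) + 2 * (2 * PI * e)) by (unfold e; field; lra).
assert (0 < 2 * PI * e) as PP by (apply Rmult_lt_0_compat; lra).
apply Rplus_le_compat; simpl.
- apply Rle_trans with ((2 * PI - 0) * e); [|lra].
  apply (norm_RInt_le_const (V := R_NormedModule)
    (fun t => fst (H (circle_point r' t)) - fst (H (circle_point r t))) 0 (2 * PI)); [lra| |].
  + intros t Ht. left. apply H1; try easy; try lra.
    rewrite Rminus_diag, Rabs_R0. apply cond_pos.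
  + apply (is_RInt_minus (V := R_NormedModule)); apply is_RInt_fst; auto.
- apply Rle_trans with ((2 * PI - 0) * e); [|lra].
  apply (norm_RInt_le_const (V := R_NormedModule)
    (fun t => snd (H (circle_point r' t)) - snd (H (circle_point r t))) 0 (2 * PI)); [lra| |].
  + intros t Ht. left. apply H2; try easy; try lra.
    rewrite Rminus_diag, Rabs_R0. apply cond_pos.
  + apply (is_RInt_minus (V := R_NormedModule)); apply is_RInt_snd; auto.
Qed.

Lemma circ_int_0 (H : C -> C) : circ_int 0 H = (RtoC (2 * PI) * H 0)%C.
Proof.
rewrite <- cint_const. apply cint_ext. intros t. f_equal.
unfold circle_point, RtoC. f_equal; ring.
Qed.

(** The circle integral is constant for radii on either side of [Cmod z0], and continuity in the
    radius carries the value across [Cmod z0] and down to radius 0. The exceptional point [z0] is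
    there for difference quotients. *)
Lemma cauchy_mean (H : C -> C) (z0 : C) (r0 : R) : 0 < r0 -> Cmod z0 < r0 ->
  (forall z, Cmod z <= r0 -> ccont H z) ->
  (forall z, Cmod z <= r0 -> z <> z0 -> exists l, cderiv H z l) ->
  circ_int r0 H = (RtoC (2 * PI) * H 0)%C.
Proof.
intros Pr Hz HC HD. rewrite <- circ_int_0.
assert (forall r1 r2, 0 < r1 -> r1 <= r2 -> r2 <= r0 -> (Cmod z0 < r1 \/ r2 < Cmod z0) ->
  circ_int r1 H = circ_int r2 H) as A.
{ intros r1 r2 L1 L2 L3 Hout. apply annulus_circ_int; auto. intros z Hzz. apply HD; [lra|].
  intros ->. lra. }
pose proof (Cmod_ge_0 z0) as P0.
enough (Cmod (circ_int r0 H - circ_int 0 H) = 0) as E.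
{ apply Cmod_eq_0 in E. replace (circ_int r0 H) with ((circ_int r0 H - circ_int 0 H) + circ_int 0 H)%C by ring.
  rewrite E. ring. }
apply cond_eq. intros eps He. rewrite Rminus_0_r, Rabs_pos_eq by apply Cmod_ge_0.
destruct (circ_int_close H r0 HC (eps / 4)) as [d [Hd Hc]]; [lra|].
destruct (Req_dec (Cmod z0) 0) as [E0|N0].
- set (s := Rmin (d / 2) r0).
  assert (0 < s) as Ps by (apply Rmin_pos; lra).
  pose proof (Rmin_l (d / 2) r0). pose proof (Rmin_r (d / 2) r0). fold s in H0, H1.
  rewrite <- (A s r0) by lra.
  eapply Rle_lt_trans; [apply Hc; try lra; rewrite Rabs_pos_eq; lra|]. lra.
(* The radii [Cmod z0 - s] and [Cmod z0 + s] are less than [d] apart and the outer one is below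
   [r0]; moreover [s <= Cmod z0 - s], so radius [s], itself close to 0, gives the same integral as
   the inner one. *)
- set (s := Rmin (d / 3) (Rmin ((r0 - Cmod z0) / 2) (Cmod z0 / 2))).
  assert (0 < s) as Ps by (repeat apply Rmin_pos; lra).
  assert (s <= d / 3) as S1 by apply Rmin_l.
  assert (s <= (r0 - Cmod z0) / 2) as S2 by (eapply Rle_trans; [apply Rmin_r|apply Rmin_l]).
  assert (s <= Cmod z0 / 2) as S3 by (eapply Rle_trans; [apply Rmin_r|apply Rmin_r]).
  rewrite <- (A (Cmod z0 + s) r0) by lra.
  eapply Rle_lt_trans; [apply (Cmod_triangle_sub _ (circ_int (Cmod z0 - s) H))|].
  rewrite <- (A s (Cmod z0 - s)) at 2 by lra.
  assert (Cmod (circ_int (Cmod z0 + s) H - circ_int (Cmod z0 - s) H) <= eps / 4).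
  { apply Hc; try lra. rewrite Rabs_pos_eq; lra. }
  assert (Cmod (circ_int s H - circ_int 0 H) <= eps / 4).
  { apply Hc; try lra. rewrite Rabs_pos_eq; lra. }
  lra.
Qed.

(** * Power series *)

Fixpoint csum (c : nat -> C) (n : nat) : C :=
  match n with O => RtoC 0 | S m => (csum c m + c m)%C end.

Fixpoint rsum (b : nat -> R) (n : nat) : R :=
  match n with O => 0 | S m => rsum b m + b m end.

Definition csum_lim (c : nat -> C) (l : C) : Prop :=
  forall eps, 0 < eps -> exists N, forall n, (N <= n)%nat -> Cmod (csum c n - l) < eps.

Lemma rsum_lim (b : nat -> R) : ex_series b ->
  forall eps, 0 < eps -> exists N, forall n, (N <= n)%nat -> Rabs (rsum b n - Series b) < eps.
Proof.
intros H eps He. apply Series_correct in H.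
assert (forall n, rsum b (S n) = sum_n b n) as E.
{ induction n as [|n IH]; [simpl; rewrite sum_O; ring|]. rewrite sum_Sn, <- IH. easy. }
destruct (proj1 (filterlim_locally _ _) H (mkposreal eps He)) as [N HN].
exists (S N). intros [|n] Hn; [lia|]. rewrite E. apply (HN n). lia.
Qed.

Lemma csum_rsum (c : nat -> C) (b : nat -> R) : (forall k, Cmod (c k) <= b k) ->
  forall n m, (n <= m)%nat -> Cmod (csum c m - csum c n) <= rsum b m - rsum b n.
Proof.
intros H n m Hnm. induction Hnm as [|m Hnm IH].
- replace (csum c n - csum c n)%C with (RtoC 0) by ring. rewrite Cmod_0. lra.
- simpl. replace (csum c m + c m - csum c n)%C with ((csum c m - csum c n) + c m)%C by ring.
  eapply Rle_trans; [apply Cmod_triangle|]. specialize (H m). lra.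
Qed.

(** The case [n = 0], where [csum] is empty, bounds the limit itself. *)
Lemma csum_lim_tail (c : nat -> C) (b : nat -> R) (l : C) :
  (forall k, Cmod (c k) <= b k) -> ex_series b -> csum_lim c l ->
  forall n, Cmod (l - csum c n) <= Series b - rsum b n.
Proof.
intros H Hb Hl n. apply le_epsilon. intros eps He.
destruct (Hl (eps / 2)) as [N1 H1]; [lra|].
destruct (rsum_lim b Hb (eps / 2)) as [N2 H2]; [lra|].
set (m := (n + N1 + N2)%nat).
specialize (H1 m ltac:(unfold m; lia)). specialize (H2 m ltac:(unfold m; lia)).
pose proof (csum_rsum c b H n m ltac:(unfold m; lia)) as H3.
pose proof (Cmod_triangle_sub l (csum c m) (csum c n)) as T.
rewrite (Cmod_minus_sym l (csum c m)) in T. apply Rabs_def2 in H2. lra.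
Qed.

Lemma csum_lim_ex (c : nat -> C) (b : nat -> R) :
  (forall k, Cmod (c k) <= b k) -> ex_series b -> exists l, csum_lim c l.
Proof.
intros H Hb. exists (Series (fun k => fst (c k)), Series (fun k => snd (c k))).
assert (ex_series (fun k => fst (c k))) as E1.
{ apply (ex_series_le (V := R_CompleteNormedModule) _ b); [|easy].
  intros k. eapply Rle_trans; [apply (fst_le_Cmod (c k))|apply H]. }
assert (ex_series (fun k => snd (c k))) as E2.
{ apply (ex_series_le (V := R_CompleteNormedModule) _ b); [|easy].
  intros k. eapply Rle_trans; [apply (snd_le_Cmod (c k))|apply H]. }
intros eps He.
destruct (rsum_lim _ E1 (eps / 2)) as [N1 H1]; [lra|].
destruct (rsum_lim _ E2 (eps / 2)) as [N2 H2]; [lra|].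
exists (N1 + N2)%nat. intros n Hn.
specialize (H1 n ltac:(lia)). specialize (H2 n ltac:(lia)).
eapply Rle_lt_trans; [apply Cmod_le_abs|].
assert (forall m, fst (csum c m) = rsum (fun k => fst (c k)) m /\
  snd (csum c m) = rsum (fun k => snd (c k)) m) as E.
{ induction m as [|m [IH1 IH2]]; [easy|]. simpl. now rewrite IH1, IH2. }
destruct (E n) as [F1 F2]. simpl. rewrite F1, F2. unfold Rminus in H1, H2. lra.
Qed.

Lemma Series_nonneg (b : nat -> R) : (forall n, 0 <= b n) -> ex_series b -> 0 <= Series b.
Proof.
intros H Hb.
assert (forall k, Cmod (RtoC (b k)) <= b k) as B.
{ intros k. rewrite Cmod_R, Rabs_pos_eq; auto. lra. }
destruct (csum_lim_ex _ b B Hb) as [l Hl].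
pose proof (csum_lim_tail _ b l B Hb Hl O) as T. simpl in T.
generalize (Cmod_ge_0 (l - 0)). lra.
Qed.

Lemma csum_lim_unique (c : nat -> C) (l l' : C) : csum_lim c l -> csum_lim c l' -> l = l'.
Proof.
intros H H'. apply NNPP. intros N.
assert (0 < Cmod (l - l')) as P.
{ apply Cmod_gt_0. intros E. apply N. replace l with ((l - l') + l')%C by ring. rewrite E. ring. }
destruct (H (Cmod (l - l') / 2)) as [N1 H1]; [lra|].
destruct (H' (Cmod (l - l') / 2)) as [N2 H2]; [lra|].
specialize (H1 (N1 + N2)%nat ltac:(lia)). specialize (H2 (N1 + N2)%nat ltac:(lia)).
pose proof (Cmod_triangle_sub l (csum c (N1 + N2)) l') as T.
rewrite (Cmod_minus_sym l (csum _ _)) in T. lra.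
Qed.

Lemma csum_ext (c c' : nat -> C) (n : nat) : (forall k, c k = c' k) -> csum c n = csum c' n.
Proof. intros E. induction n; simpl; [easy|]. now rewrite IHn, E. Qed.

Lemma csum_scal (x : C) (c : nat -> C) (n : nat) : csum (fun k => x * c k)%C n = (x * csum c n)%C.
Proof. induction n; simpl; [ring|]. rewrite IHn. ring. Qed.

Lemma csum_head (c : nat -> C) (n : nat) : csum c (S n) = (c O + csum (fun k => c (S k)) n)%C.
Proof. induction n; [simpl; ring|]. simpl in *. rewrite IHn. ring. Qed.

(** Radius of convergence at least 1, in the form that supplies a summable majorant on each disc
    [Cmod z <= r]. *)
Definition absc (a : nat -> C) : Prop :=
  forall r, 0 <= r < 1 -> ex_series (fun n => Cmod (a n) * r ^ n).

Definition has_psum (f : C -> C) (a : nat -> C) : Prop :=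
  absc a /\ forall z, disc z -> csum_lim (fun k => a k * z ^ k)%C (f z).

Lemma pterm_le (a : nat -> C) (z : C) (r : R) : Cmod z <= r ->
  forall k, Cmod (a k * z ^ k)%C <= Cmod (a k) * r ^ k.
Proof.
intros Hz k. rewrite Cmod_mult, Cmod_pow. apply Rmult_le_compat_l; [apply Cmod_ge_0|].
apply pow_incr. split; [apply Cmod_ge_0|easy].
Qed.

Lemma absc_has_psum (a : nat -> C) : absc a -> exists f, has_psum f a.
Proof.
intros Ha.
assert (forall z, exists s, disc z -> csum_lim (fun k => a k * z ^ k)%C s) as E.
{ intros z. destruct (classic (disc z)) as [Hz|Hz]; [|exists 0; easy].
  destruct (csum_lim_ex (fun k => a k * z ^ k)%C (fun k => Cmod (a k) * Cmod z ^ k)) as [s Hs].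
  - now apply pterm_le.
  - apply Ha. split; [apply Cmod_ge_0|easy].
  - now exists s. }
exists (fun z => proj1_sig (constructive_indefinite_description _ (E z))).
split; [easy|]. intros z. apply (proj2_sig (constructive_indefinite_description _ (E z))).
Qed.

Lemma has_psum_tail (f : C -> C) (a : nat -> C) (r : R) : has_psum f a -> r < 1 ->
  forall eps, 0 < eps -> exists N, forall n z, (N <= n)%nat -> Cmod z <= r ->
    Cmod (f z - csum (fun k => a k * z ^ k)%C n) <= eps.
Proof.
intros [Ha Hf] Hr eps He.
destruct (Rlt_le_dec r 0) as [Nr|Pr].
{ exists O. intros n z _ Hz. generalize (Cmod_ge_0 z). lra. }
destruct (rsum_lim _ (Ha r (conj Pr Hr)) eps He) as [N HN].
exists N. intros n z Hn Hz. specialize (HN n Hn).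
eapply Rle_trans.
- apply (csum_lim_tail _ (fun k => Cmod (a k) * r ^ k)); auto using pterm_le.
  apply Hf. unfold disc. lra.
- apply Rabs_def2 in HN. lra.
Qed.

Lemma has_psum_bounded (f : C -> C) (a : nat -> C) (r : R) : has_psum f a -> r < 1 ->
  exists M, 0 <= M /\ forall z, Cmod z <= r -> Cmod (f z) <= M.
Proof.
intros [Ha Hf] Hr.
destruct (Rlt_le_dec r 0) as [Nr|Pr].
{ exists 0. split; [lra|]. intros z Hz. generalize (Cmod_ge_0 z). lra. }
exists (Series (fun k => Cmod (a k) * r ^ k)).
assert (forall z, Cmod z <= r -> Cmod (f z) <= Series (fun k => Cmod (a k) * r ^ k)) as B.
{ intros z Hz. replace (f z) with (f z - csum (fun k => a k * z ^ k)%C O)%C by (simpl; ring).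
  eapply Rle_trans; [apply (csum_lim_tail _ (fun k => Cmod (a k) * r ^ k)); auto using pterm_le|].
  - apply Hf. unfold disc. lra.
  - simpl. lra. }
split; [|easy]. apply Rle_trans with (Cmod (f 0)); [apply Cmod_ge_0|]. apply B. now rewrite Cmod_0.
Qed.

(** * Termwise differentiation of power series *)

Definition dcoef (a : nat -> C) (n : nat) : C := (RtoC (INR (S n)) * a (S n))%C.

(* Convexity: the tangent slope of [x ^ n] at [s] is at most its chord slope on [[s, r]]. *)
Lemma pow_derive_le (s r : R) (n : nat) : 0 <= s -> s < r ->
  INR n * s ^ pred n <= r ^ n / (r - s).
Proof.
intros Hs Hr. assert (0 < / (r - s)) as P by (apply Rinv_0_lt_compat; lra).
induction n as [|n IH].
- simpl. unfold Rdiv. lra.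
- simpl pred.
  replace (INR (S n) * s ^ n) with (s * (INR n * s ^ pred n) + s ^ n).
  2:{ rewrite S_INR. destruct n; simpl; ring. }
  replace (r ^ S n / (r - s)) with (s * (r ^ n / (r - s)) + r ^ n) by (simpl; field; lra).
  apply Rplus_le_compat; [now apply Rmult_le_compat_l|]. apply pow_incr. lra.
Qed.

(** A quadratic remainder whose dependence on [n] is only [r ^ n], so that it can be summed against
    coefficients satisfying [absc]. The induction closes because [s + (r - s) = r]. *)
Lemma pow_taylor (s r : R) (z w : C) (n : nat) : 0 <= s -> s < r -> Cmod z <= s -> Cmod w <= s ->
  Cmod (w ^ n - z ^ n - RtoC (INR n) * z ^ pred n * (w - z))%C
  <= r ^ n * (Cmod (w - z) ^ 2 / (r - s) ^ 2).
Proof.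
intros Hs Hr Hz Hw. set (K := Cmod (w - z) ^ 2).
assert (0 <= K) as PK by apply pow2_ge_0.
assert (0 < / (r - s)) as P by (apply Rinv_0_lt_compat; lra).
induction n as [|n IH].
- simpl. replace (1 - 1 - 0 * 1 * (w - z))%C with (RtoC 0) by ring. rewrite Cmod_0.
  rewrite Rmult_1_l. apply Rdiv_le_0_compat; [easy|]. apply (pow_lt (r - s) 2). lra.
- replace (w ^ S n - z ^ S n - RtoC (INR (S n)) * z ^ pred (S n) * (w - z))%C
    with (w * (w ^ n - z ^ n - RtoC (INR n) * z ^ pred n * (w - z))
          + RtoC (INR n) * z ^ pred n * ((w - z) * (w - z)))%C.
  2:{ rewrite S_INR, RtoC_plus. destruct n; simpl; ring. }
  eapply Rle_trans; [apply Cmod_triangle|].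
  replace (r ^ S n * (K / (r - s) ^ 2))
    with (s * (r ^ n * (K / (r - s) ^ 2)) + r ^ n / (r - s) * K) by (simpl; field; lra).
  apply Rplus_le_compat.
  + rewrite Cmod_mult. apply Rmult_le_compat; auto using Cmod_ge_0.
  + rewrite 3!Cmod_mult, Cmod_R, Cmod_pow. rewrite Rabs_pos_eq by apply pos_INR.
    replace (Cmod (w - z) * Cmod (w - z)) with K by (unfold K; ring).
    apply Rmult_le_compat_r; [easy|].
    apply Rle_trans with (INR n * s ^ pred n); [|now apply pow_derive_le].
    apply Rmult_le_compat_l; [apply pos_INR|]. apply pow_incr. split; [apply Cmod_ge_0|easy].
Qed.

Lemma ex_series_scal_R (c : R) (b : nat -> R) : ex_series b -> ex_series (fun n => c * b n).
Proof. apply (ex_series_scal_l (K := R_AbsRing) (V := R_NormedModule) c b). Qed.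

Lemma absc_dcoef (a : nat -> C) : absc a -> absc (dcoef a).
Proof.
intros Ha s Hs. set (r := (1 + s) / 2).
apply (ex_series_le (V := R_CompleteNormedModule) _
  (fun n => / (r - s) * (Cmod (a (S n)) * r ^ S n))).
- intros n. change (norm (Cmod (dcoef a n) * s ^ n)) with (Rabs (Cmod (dcoef a n) * s ^ n)).
  rewrite Rabs_pos_eq by (apply Rmult_le_pos; [apply Cmod_ge_0|apply pow_le; lra]).
  unfold dcoef. rewrite Cmod_mult, Cmod_R, Rabs_pos_eq by apply pos_INR.
  pose proof (pow_derive_le s r (S n) ltac:(lra) ltac:(unfold r; lra)) as B. simpl pred in B.
  replace (/ (r - s) * (Cmod (a (S n)) * r ^ S n))
    with (Cmod (a (S n)) * (r ^ S n / (r - s))) by (unfold Rdiv; ring).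
  replace (INR (S n) * Cmod (a (S n)) * s ^ n) with (Cmod (a (S n)) * (INR (S n) * s ^ n)) by ring.
  apply Rmult_le_compat_l; [apply Cmod_ge_0|easy].
- apply ex_series_scal_R.
  apply (ex_series_incr_1 (V := R_NormedModule) (fun n => Cmod (a n) * r ^ n)).
  apply Ha. unfold r. lra.
Qed.

(** The remainders of [pow_taylor] sum to a constant times [Cmod (w - z) ^ 2], which is negligible
    against [Cmod (w - z)]. *)
Lemma has_psum_cderiv (f f' : C -> C) (a : nat -> C) : has_psum f a -> has_psum f' (dcoef a) ->
  forall z, disc z -> cderiv f z (f' z).
Proof.
intros [Ha Hf] [_ Hf'] z Hz. unfold disc in Hz. pose proof (Cmod_ge_0 z) as Pz.
(* The two points trisecting the interval from [Cmod z] to 1: [w] stays within [s], and [r] is the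
   radius of the majorant. *)
set (s := (2 * Cmod z + 1) / 3). set (r := (Cmod z + 2) / 3).
assert (Cmod z < s /\ s < r /\ r < 1) as [L1 [L2 L3]] by (unfold s, r; lra).
set (K := Series (fun n => Cmod (a n) * r ^ n) / (r - s) ^ 2).
assert (forall w, Cmod w <= s ->
  Cmod (f w - f z - f' z * (w - z)) <= Cmod (w - z) ^ 2 * K) as B.
{ intros w Hw.
  set (c := fun n => (a n * (w ^ n - z ^ n - RtoC (INR n) * z ^ pred n * (w - z)))%C).
  set (h2 := Cmod (w - z) ^ 2 / (r - s) ^ 2).
  assert (0 <= h2) as Ph by (apply Rdiv_le_0_compat; [apply pow2_ge_0|apply pow_lt; lra]).
  assert (csum_lim c (f w - f z - f' z * (w - z))) as Lim.
  { intros eps He.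
    set (L := Cmod (w - z) + 1).
    assert (0 < L) by (unfold L; generalize (Cmod_ge_0 (w - z)); lra).
    assert (disc w) as Dw by (unfold disc; lra).
    destruct (Hf w Dw (eps / 4)) as [N1 H1]; [lra|].
    destruct (Hf z Hz (eps / 4)) as [N2 H2]; [lra|].
    destruct (Hf' z Hz (eps / 4 / L)) as [N3 H3]; [apply Rdiv_lt_0_compat; lra|].
    exists (N1 + N2 + N3 + 1)%nat. intros [|n] Hn; [lia|].
    specialize (H1 (S n) ltac:(lia)). specialize (H2 (S n) ltac:(lia)). specialize (H3 n ltac:(lia)).
    (* The derived series is one term shorter, because the constant term contributes no
       derivative. *)
    assert (forall m, csum c (S m) = (csum (fun k => a k * w ^ k) (S m)
      - csum (fun k => a k * z ^ k) (S m) - csum (fun k => dcoef a k * z ^ k) m * (w - z))%C) as E.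
    { assert (forall x m, csum x (S m) = (csum x m + x m)%C) as CS by easy.
      induction m as [|m IH]; [unfold c; simpl; ring|].
      rewrite (CS c (S m)), IH, (CS (fun k => a k * w ^ k)%C (S m)), (CS (fun k => a k * z ^ k)%C (S m)),
        (CS (fun k => dcoef a k * z ^ k)%C m).
      unfold c, dcoef. simpl pred. ring. }
    rewrite E.
    replace (csum (fun k => a k * w ^ k) (S n) - csum (fun k => a k * z ^ k) (S n)
      - csum (fun k => dcoef a k * z ^ k) n * (w - z) - (f w - f z - f' z * (w - z)))%C
      with ((csum (fun k => a k * w ^ k) (S n) - f w) - (csum (fun k => a k * z ^ k) (S n) - f z)
      - (csum (fun k => dcoef a k * z ^ k) n - f' z) * (w - z))%C by ring.
    eapply Rle_lt_trans; [apply Cmod_triangle_minus|].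
    eapply Rle_lt_trans; [apply Rplus_le_compat_r, Cmod_triangle_minus|].
    rewrite Cmod_mult.
    assert (Cmod (csum (fun k => dcoef a k * z ^ k)%C n - f' z) * Cmod (w - z) <= eps / 4).
    { apply Rle_trans with (eps / 4 / L * L); [|right; field; lra].
      apply Rmult_le_compat; auto using Cmod_ge_0; unfold L in *; lra. }
    lra. }
  pose proof (csum_lim_tail c (fun n => h2 * (Cmod (a n) * r ^ n))
    (f w - f z - f' z * (w - z))%C) as T.
  replace (f w - f z - f' z * (w - z))%C
    with (f w - f z - f' z * (w - z) - csum c O)%C by (simpl; ring).
  eapply Rle_trans; [apply T; auto|].
  - intros k. unfold c. rewrite Cmod_mult.
    replace (h2 * (Cmod (a k) * r ^ k)) with (Cmod (a k) * (r ^ k * h2)) by ring.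
    apply Rmult_le_compat_l; [apply Cmod_ge_0|]. apply pow_taylor; lra.
  - apply ex_series_scal_R, Ha. lra.
  - rewrite Series_scal_l. simpl rsum. unfold h2, K. right. field. lra. }
assert (0 <= K) as PK.
{ apply Rdiv_le_0_compat; [|apply pow_lt; lra]. apply Series_nonneg; [|apply Ha; lra].
  intros n. apply Rmult_le_pos; [apply Cmod_ge_0|apply pow_le; lra]. }
intros eps He.
exists (Rmin (s - Cmod z) (eps / (K + 1))). split.
{ apply Rmin_pos; [lra|]. apply Rdiv_lt_0_compat; lra. }
intros w Hw.
assert (Cmod (w - z) < s - Cmod z) as B1 by (eapply Rlt_le_trans; [apply Hw|apply Rmin_l]).
assert (Cmod (w - z) < eps / (K + 1)) as B2 by (eapply Rlt_le_trans; [apply Hw|apply Rmin_r]).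
pose proof (Cmod_ge_0 (w - z)) as Pw.
eapply Rle_trans; [apply B|].
{ pose proof (Cmod_le_sub w z). lra. }
apply (Rmult_lt_compat_r (K + 1)) in B2; [|lra].
replace (eps / (K + 1) * (K + 1)) with eps in B2 by (field; lra).
simpl. nra.
Qed.

(** * Taylor expansion *)

Lemma ccont_mult (f h : C -> C) (z : C) : ccont f z -> ccont h z ->
  ccont (fun w => f w * h w)%C z.
Proof.
intros Hf Hh eps He.
set (A := Cmod (h z) + 1). set (D := Cmod (f z) + 1).
assert (0 < A /\ 0 < D) as [PA PD].
{ unfold A, D. generalize (Cmod_ge_0 (h z)) (Cmod_ge_0 (f z)). lra. }
destruct (Hf (eps / 2 / A)) as [d1 [P1 H1]]; [apply Rdiv_lt_0_compat; lra|].
destruct (Hh (Rmin 1 (eps / 2 / D))) as [d2 [P2 H2]].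
{ apply Rmin_pos; [lra|]. apply Rdiv_lt_0_compat; lra. }
exists (Rmin d1 d2). split; [now apply Rmin_pos|]. intros w Bw.
specialize (H1 w (Rlt_le_trans _ _ _ Bw (Rmin_l _ _))).
specialize (H2 w (Rlt_le_trans _ _ _ Bw (Rmin_r _ _))).
pose proof (Rmin_l 1 (eps / 2 / D)). pose proof (Rmin_r 1 (eps / 2 / D)).
assert (Cmod (h w) <= A) as HA.
{ unfold A. pose proof (Cmod_le_sub (h w) (h z)). lra. }
replace (f w * h w - f z * h z)%C with ((f w - f z) * h w + f z * (h w - h z))%C by ring.
eapply Rle_lt_trans; [apply Cmod_triangle|]. rewrite 2!Cmod_mult.
assert (Cmod (f w - f z) * Cmod (h w) <= eps / 2 / A * A).
{ apply Rmult_le_compat; auto using Cmod_ge_0. lra. }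
assert (Cmod (f z) * Cmod (h w - h z) < D * (eps / 2 / D)).
{ apply Rle_lt_trans with (Cmod (f z) * (eps / 2 / D)).
  - apply Rmult_le_compat_l; [apply Cmod_ge_0|lra].
  - apply Rmult_lt_compat_r; [apply Rdiv_lt_0_compat; lra|unfold D; lra]. }
replace (eps / 2 / A * A) with (eps / 2) in * by (field; lra).
replace (D * (eps / 2 / D)) with (eps / 2) in * by (field; lra). lra.
Qed.

Lemma pcont_bounded (f : R -> C) : pcont f ->
  exists M, 0 <= M /\ forall t, 0 <= t <= 2 * PI -> Cmod (f t) <= M.
Proof.
intros H. destruct (continuity_ab_maj (fun t => Cmod (f t)) 0 (2 * PI)) as [m [Hm _]].
- generalize PI_RGT_0; lra.
- intros t _. apply continuity_pt_filterlim. now apply pcont_Cmod.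
- exists (Cmod (f m)). split; [apply Cmod_ge_0|easy].
Qed.

Lemma cderiv_inv_pow (k : nat) (z : C) : z <> 0 -> exists l, cderiv (fun w => (/ w) ^ k)%C z l.
Proof.
intros Hz. destruct (cderiv_pow k (/ z)%C) as [l Hl]. eexists.
apply (cderiv_comp (fun w => w ^ k)%C (fun w => / w)%C); [now apply cderiv_inv|apply Hl].
Qed.

Lemma circle_point_neq_0 (r t : R) : 0 < r -> circle_point r t <> 0.
Proof. intros Hr. apply Cmod_gt_0. now rewrite Cmod_circle_point, Rabs_pos_eq; lra. Qed.

Lemma circ_int_inv_pow_0 (r : R) : circ_int r (fun w => (/ w) ^ 0)%C = RtoC (2 * PI).
Proof. unfold circ_int. simpl. rewrite cint_const. ring. Qed.

(* The integral does not depend on the radius and is [O(r^-k)] as [r] grows. *)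
Lemma circ_int_inv_pow (r : R) (k : nat) : 0 < r ->
  circ_int r (fun w => (/ w) ^ S k)%C = 0.
Proof.
intros Hr. apply Cmod_eq_0, cond_eq. intros eps He.
rewrite Rminus_0_r, Rabs_pos_eq by apply Cmod_ge_0.
pose proof PI_RGT_0 as Ppi.
set (s := r + 1 + 2 * PI / eps).
assert (0 < 2 * PI / eps) by (apply Rdiv_lt_0_compat; lra).
assert (1 < s /\ r <= s) as [Ps Prs] by (unfold s; lra).
rewrite (annulus_circ_int _ r s); [|easy|easy|].
2:{ intros z Hz. apply cderiv_inv_pow. apply Cmod_gt_0. lra. }
apply Rle_lt_trans with (2 * PI * / s).
- apply cint_norm_le_const.
  + apply (pcont_circle (fun w => (/ w) ^ S k)%C). intros t.
    destruct (cderiv_inv_pow (S k) (circle_point s t)) as [l Hl].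
    { apply circle_point_neq_0; lra. }
    now apply cderiv_ccont in Hl.
  + intros t _. rewrite Cmod_pow, Cmod_inv by (apply circle_point_neq_0; lra).
    rewrite Cmod_circle_point, Rabs_pos_eq by lra. simpl.
    assert (0 < / s <= 1) as [I1 I2].
    { split; [apply Rinv_0_lt_compat; lra|]. rewrite <- Rinv_1. apply Rinv_le_contravar; lra. }
    apply Rle_trans with (/ s * 1); [|lra].
    apply Rmult_le_compat_l; [lra|]. rewrite <- (pow1 k). apply pow_incr. lra.
- apply (Rmult_lt_reg_r s); [lra|]. rewrite Rmult_assoc, Rinv_l, Rmult_1_r by lra.
  unfold s. replace (eps * (r + 1 + 2 * PI / eps)) with (eps * r + eps + 2 * PI) by (field; lra).
  assert (0 < eps * r) by now apply Rmult_lt_0_compat. lra.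
Qed.

Section Taylor.
Variable f : C -> C.
Hypothesis Hf : analytic_on_disc f.

Let f_cderiv (z : C) : Cmod z < 1 -> exists l, cderiv f z l.
Proof. intros Hz. now apply analytic_cderiv. Qed.

Lemma taylor_integrand_cderiv (k : nat) (z : C) : z <> 0 -> Cmod z < 1 ->
  exists l, cderiv (fun w => f w * (/ w) ^ k)%C z l.
Proof.
intros Nz Hz. destruct (f_cderiv z Hz) as [l Hl]. destruct (cderiv_inv_pow k z Nz) as [m Hm].
eexists. apply (cderiv_mult f (fun w => (/ w) ^ k)%C); eassumption.
Qed.

Lemma taylor_integrand_pcont (k : nat) (r : R) : 0 < r < 1 ->
  pcont (fun t => f (circle_point r t) * (/ circle_point r t) ^ k)%C.
Proof.
intros Hr. apply (pcont_circle (fun w => f w * (/ w) ^ k)%C). intros t.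
destruct (taylor_integrand_cderiv k (circle_point r t)) as [l Hl].
- apply circle_point_neq_0; lra.
- rewrite Cmod_circle_point, Rabs_pos_eq; lra.
- now apply cderiv_ccont in Hl.
Qed.

(** Cauchy's coefficient formula in polar form, where the factor [w] of [dw] lowers the exponent
    from [k + 1] to [k]. By [taylor_coef_circ_int] any radius in [(0, 1)] would serve as well as
    [1 / 2]. *)
Definition taylor_coef (k : nat) : C :=
  (RtoC (/ (2 * PI)) * circ_int (1 / 2) (fun w => f w * (/ w) ^ k))%C.

Lemma taylor_coef_circ_int (k : nat) (r : R) : 0 < r < 1 ->
  circ_int r (fun w => f w * (/ w) ^ k)%C = (RtoC (2 * PI) * taylor_coef k)%C.
Proof.
intros Hr. unfold taylor_coef. pose proof PI_RGT_0.
rewrite Cmult_assoc, <- RtoC_mult, Rinv_r, Cmult_1_l by lra.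
destruct (Rle_lt_dec r (1 / 2)); [|symmetry]; (apply annulus_circ_int; [lra|lra|]);
  intros z Hz; (apply taylor_integrand_cderiv; [apply Cmod_gt_0|]; lra).
Qed.

(** Cauchy's estimate on a circle of radius [s] between [r] and 1 gives the geometric majorant
    [M * (r / s) ^ n]. *)
Lemma absc_taylor_coef : absc taylor_coef.
Proof.
intros r Hr. set (s := (1 + r) / 2). assert (r < s < 1) as Hs by (unfold s; lra).
pose proof PI_RGT_0 as Ppi.
destruct (pcont_bounded (fun t => f (circle_point s t) * (/ circle_point s t) ^ 0)%C) as [M [PM HM]].
{ apply taylor_integrand_pcont; lra. }
apply (ex_series_le (V := R_CompleteNormedModule) _ (fun n => M * (r / s) ^ n)).
2:{ apply ex_series_scal_R, ex_series_geom.
    rewrite Rabs_pos_eq by (apply Rdiv_le_0_compat; lra).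
    apply (Rmult_lt_reg_r s); [lra|]. unfold Rdiv. rewrite Rmult_assoc, Rinv_l; lra. }
intros n. change (norm ?x) with (Rabs x).
assert (0 < s ^ n) as Psn by (apply pow_lt; lra).
assert (Cmod (taylor_coef n) <= M * / s ^ n) as B.
{ apply (Rmult_le_reg_l (2 * PI)); [lra|].
  rewrite <- (Rabs_pos_eq (2 * PI)) at 1 by lra. rewrite <- Cmod_R, <- Cmod_mult.
  rewrite <- (taylor_coef_circ_int n s) by lra.
  apply cint_norm_le_const; [apply taylor_integrand_pcont; lra|].
  intros t Ht. specialize (HM t Ht). simpl in HM. rewrite Cmult_1_r in HM.
  assert (circle_point s t <> 0) by (apply circle_point_neq_0; lra).
  rewrite Cmod_mult, Cmod_pow, Cmod_inv by easy.
  rewrite Cmod_circle_point, Rabs_pos_eq by lra. rewrite pow_inv.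
  apply Rmult_le_compat_r; [|easy]. left. now apply Rinv_0_lt_compat. }
assert (0 <= r ^ n) as Prn by (apply pow_le; lra).
rewrite Rabs_pos_eq by (apply Rmult_le_pos; [apply Cmod_ge_0|easy]).
unfold Rdiv. rewrite Rpow_mult_distr, pow_inv.
replace (M * (r ^ n * / s ^ n)) with (M * / s ^ n * r ^ n) by ring.
now apply Rmult_le_compat_r.
Qed.

(* With [H w = w (f w - f z) / (w - z)], which integrates to [2 PI * H 0 = 0], the
   identity [H w = (f w - f z) + (z / w) H w] is iterated and integrated. *)
Lemma taylor_expansion (z : C) : disc z ->
  csum_lim (fun k => taylor_coef k * z ^ k)%C (f z).
Proof.
intros Hz. unfold disc in Hz. pose proof (Cmod_ge_0 z) as Pz.
set (s := (1 + Cmod z) / 2). assert (Cmod z < s /\ s < 1) as [Hs1 Hs2] by (unfold s; lra).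
assert (0 < s) as Ps by lra. pose proof PI_RGT_0 as Ppi.
destruct (f_cderiv z Hz) as [l Hl].
(* The value [l] at [z] makes the difference quotient continuous there, which is what [cauchy_mean]
   asks of its exceptional point. *)
set (q := fun w => if Ceq_dec w z then l else ((f w - f z) * / (w - z))%C).
assert (forall w, w <> z -> q w = ((f w - f z) * / (w - z))%C) as Eq.
{ intros w Hw. unfold q. now destruct (Ceq_dec w z). }
set (H := fun w => (q w * w)%C).
assert (forall w, Cmod w < 1 -> w <> z -> exists m, cderiv H w m) as HD.
{ intros w Hw Nw. destruct (f_cderiv w Hw) as [m Hm].
  assert (w - z <> 0)%C as Nwz.
  { intros E. apply Nw. replace w with ((w - z) + z)%C by ring. rewrite E. ring. }
  eexists. apply (cderiv_mult q (fun w => w)); [|apply cderiv_id].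
  apply (cderiv_ext_loc (fun w => (f w + - f z) * / (w + - z))%C q w _ (Cmod (w - z))).
  - now apply Cmod_gt_0.
  - intros w' Hw'. rewrite Eq; [easy|]. intros ->. rewrite Cmod_minus_sym in Hw'. lra.
  - apply (cderiv_mult (fun w => f w + - f z)%C (fun w => / (w + - z))%C).
    + apply (cderiv_plus f (fun _ => - f z)%C); [exact Hm|apply cderiv_const].
    + apply (cderiv_comp (fun w => / w)%C (fun w => w + - z)%C).
      * apply (cderiv_plus (fun w => w) (fun _ => - z)%C); [apply cderiv_id|apply cderiv_const].
      * now apply cderiv_inv. }
assert (forall w, Cmod w < 1 -> ccont H w) as HC.
{ intros w Hw. destruct (Ceq_dec w z) as [->|Nw].
  2:{ destruct (HD w Hw Nw) as [m Hm]. now apply cderiv_ccont in Hm. }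
  apply ccont_mult.
  - intros eps He. destruct (Hl (eps / 2)) as [d [Hd Hw']]; [lra|]. exists d; split; [easy|].
    intros w Bw. unfold q at 2. destruct (Ceq_dec z z) as [_|N]; [|easy].
    destruct (Ceq_dec w z) as [->|Nw].
    + unfold q. destruct (Ceq_dec z z) as [_|N]; [|easy].
      replace (l - l)%C with (RtoC 0) by ring. now rewrite Cmod_0.
    + rewrite Eq by easy.
      assert (w - z <> 0)%C as Nwz.
      { intros E. apply Nw. replace w with ((w - z) + z)%C by ring. rewrite E. ring. }
      replace ((f w - f z) * / (w - z) - l)%C with ((f w - f z - l * (w - z)) * / (w - z))%C
        by (field; easy).
      rewrite Cmod_mult, Cmod_inv by easy. apply Cmod_gt_0 in Nwz.
      apply Rle_lt_trans with (eps / 2 * Cmod (w - z) * / Cmod (w - z)).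
      * apply Rmult_le_compat_r; [left; now apply Rinv_0_lt_compat|auto].
      * rewrite Rmult_assoc, Rinv_r; lra.
  - apply (cderiv_ccont _ z 1), cderiv_id. }
assert (forall t, circle_point s t <> 0) as Cn0 by (intros; now apply circle_point_neq_0).
assert (forall t, Cmod (circle_point s t) = s) as Cs.
{ intros. rewrite Cmod_circle_point, Rabs_pos_eq; lra. }
set (rem := fun n => circ_int s (fun w => (z * / w) ^ n * H w)%C).
assert (forall n, pcont (fun t => (z * / circle_point s t) ^ n * H (circle_point s t))%C) as PCr.
{ intros n. apply (pcont_circle (fun w => (z * / w) ^ n * H w)%C). intros t.
  apply ccont_mult; [|apply HC; rewrite Cs; lra].
  destruct (cderiv_pow n (z * / circle_point s t)%C) as [m Hm].
  eapply cderiv_ccont.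
  apply (cderiv_comp (fun w => w ^ n)%C (fun w => z * / w)%C); [|apply Hm].
  apply (cderiv_scal z (fun w => / w)%C). now apply cderiv_inv. }
assert (rem O = 0) as R0.
{ unfold rem. unfold circ_int. rewrite (cint_ext _ (fun t => H (circle_point s t))).
  2:{ intros t. simpl. ring. }
  change (circ_int s H = 0). rewrite (cauchy_mean H z s); auto.
  - unfold H. ring.
  - intros w Hw. apply HC. lra.
  - intros w Hw. apply HD. lra. }
assert (forall n, rem n = (z ^ n * (RtoC (2 * PI) * taylor_coef n)
  + (- (z ^ n * f z)) * circ_int s (fun w => (/ w) ^ n) + rem (S n))%C) as Step.
{ intros n. rewrite <- (taylor_coef_circ_int n s) by lra.
  assert (pcont (fun t => (/ circle_point s t) ^ n)%C) as PC.
  { apply (pcont_circle (fun w => (/ w) ^ n)%C). intros t.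
    destruct (cderiv_inv_pow n (circle_point s t) (Cn0 t)) as [m Hm].
    now apply cderiv_ccont in Hm. }
  pose proof (taylor_integrand_pcont n s ltac:(lra)) as PT.
  unfold circ_int, rem.
  rewrite <- (cint_scal (z ^ n)) by easy. rewrite <- (cint_scal (- (z ^ n * f z))) by easy.
  unfold circ_int. rewrite <- cint_plus; auto using pcont_scal.
  rewrite <- cint_plus; auto using pcont_plus, pcont_scal.
  apply cint_ext. intros t. set (w := circle_point s t).
  assert (w <> 0) as Nw by apply Cn0.
  assert (w - z <> 0)%C as Nwz.
  { intros E. assert (w = z) as E'.
    { replace w with ((w - z) + z)%C by ring. rewrite E. ring. }
    pose proof (Cs t) as E''. fold w in E''. rewrite E' in E''. lra. }
  unfold H. rewrite Eq.
  2:{ intros E'. apply Nwz. rewrite E'. ring. }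
  rewrite Cpow_S, !Cpow_mult_l. field. auto. }
(* The integral of [(/ w) ^ n] is nonzero only for [n = 0]; that single stage brings in [f z], and
   each later one removes a Taylor term. *)
assert (forall n, RtoC (2 * PI) * (f z - csum (fun k => taylor_coef k * z ^ k) (S n)) = rem (S n))%C as Sum.
{ induction n as [|n IH].
  - pose proof (Step O) as E. rewrite R0, circ_int_inv_pow_0 in E.
    simpl csum. simpl Cpow in E. simpl Cpow.
    replace (rem 1%nat) with (1 * (RtoC (2 * PI) * taylor_coef 0) + - (1 * f z) * RtoC (2 * PI) + rem 1%nat
      - (1 * (RtoC (2 * PI) * taylor_coef 0) + - (1 * f z) * RtoC (2 * PI)))%C by ring.
    rewrite <- E. ring.
  - pose proof (Step (S n)) as E. rewrite circ_int_inv_pow in E by easy.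
    replace (csum (fun k => taylor_coef k * z ^ k) (S (S n)))%C
      with (csum (fun k => taylor_coef k * z ^ k) (S n) + taylor_coef (S n) * z ^ S n)%C by easy.
    replace (RtoC (2 * PI) * (f z - (csum (fun k => taylor_coef k * z ^ k) (S n) + taylor_coef (S n) * z ^ S n)))%C
      with (RtoC (2 * PI) * (f z - csum (fun k => taylor_coef k * z ^ k) (S n))
            - z ^ S n * (RtoC (2 * PI) * taylor_coef (S n)))%C by ring.
    rewrite IH, E. ring. }
destruct (pcont_bounded (fun t => (z * / circle_point s t) ^ 0 * H (circle_point s t))%C (PCr O)) as [M [PM HM]].
intros eps He.
set (x := Cmod z / s).
assert (0 <= x < 1) as Hx.
{ unfold x. split; [apply Rdiv_le_0_compat; lra|].
  apply (Rmult_lt_reg_r s); [lra|]. unfold Rdiv. rewrite Rmult_assoc, Rinv_l; lra. }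
destruct (pow_lt_1_zero x) with (y := eps / (M + 1)) as [N HN].
{ rewrite Rabs_pos_eq; lra. } { apply Rdiv_lt_0_compat; lra. }
exists (S N). intros [|n] Hn; [lia|].
specialize (HN (S n) ltac:(lia)). rewrite Rabs_pos_eq in HN by (apply pow_le; lra).
rewrite Cmod_minus_sym.
apply (Rmult_lt_reg_l (2 * PI)); [lra|].
rewrite <- (Rabs_pos_eq (2 * PI)) at 1 by lra. rewrite <- Cmod_R, <- Cmod_mult, Sum.
apply Rle_lt_trans with (2 * PI * (x ^ S n * M)).
- unfold rem. apply cint_norm_le_const; [apply PCr|].
  intros t Ht. specialize (HM t Ht). cbn [Cpow] in HM. rewrite Cmult_1_l in HM.
  rewrite Cmod_mult, Cmod_pow, Cmod_mult, Cmod_inv by easy. rewrite Cs.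
  apply Rmult_le_compat_l; [apply pow_le; lra|easy].
- apply Rmult_lt_compat_l; [lra|].
  apply (Rmult_lt_compat_r (M + 1)) in HN; [|lra].
  replace (eps / (M + 1) * (M + 1)) with eps in HN by (field; lra).
  assert (0 <= x ^ S n) by (apply pow_le; lra). lra.
Qed.
End Taylor.

(** * Analytic functions as sums of power series *)

Lemma analytic_has_psum (f : C -> C) : analytic_on_disc f -> exists a, has_psum f a.
Proof.
intros Hf. exists (taylor_coef f). split; [now apply absc_taylor_coef|].
intros z. now apply taylor_expansion.
Qed.

Lemma has_psum_analytic (f : C -> C) (a : nat -> C) : has_psum f a -> analytic_on_disc f.
Proof.
intros Hf. apply analytic_cderiv. intros z Hz.
destruct (absc_has_psum (dcoef a)) as [f' Hf']; [apply absc_dcoef, Hf|].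
exists (f' z). now apply (has_psum_cderiv f f' a).
Qed.

Lemma analytic_ext (f h : C -> C) : (forall z, disc z -> f z = h z) ->
  analytic_on_disc f -> analytic_on_disc h.
Proof.
intros E Hf. rewrite analytic_cderiv in *. intros z Hz. destruct (Hf z Hz) as [l Hl].
exists l. apply (cderiv_ext_loc f h z l (1 - Cmod z)); [unfold disc in Hz; lra| |easy].
intros w Hw. apply E. unfold disc. pose proof (Cmod_le_sub w z). lra.
Qed.

Lemma analytic_C_derive_analytic (f : C -> C) : analytic_on_disc f ->
  analytic_on_disc (C_derive f).
Proof.
intros Hf. destruct (analytic_has_psum f Hf) as [a Ha].
destruct (absc_has_psum (dcoef a)) as [f' Hf']; [apply absc_dcoef, Ha|].
apply (analytic_ext f'); [|now apply has_psum_analytic with (dcoef a)].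
intros z Hz. symmetry. apply cderiv_C_derive. now apply (has_psum_cderiv f f' a).
Qed.

Lemma analytic_plus (f h : C -> C) : analytic_on_disc f -> analytic_on_disc h ->
  analytic_on_disc (fun z => f z + h z)%C.
Proof.
rewrite !analytic_cderiv. intros Hf Hh z Hz. destruct (Hf z Hz), (Hh z Hz).
eexists. now apply cderiv_plus; eassumption.
Qed.

Lemma analytic_mult (f h : C -> C) : analytic_on_disc f -> analytic_on_disc h ->
  analytic_on_disc (fun z => f z * h z)%C.
Proof.
rewrite !analytic_cderiv. intros Hf Hh z Hz. destruct (Hf z Hz), (Hh z Hz).
eexists. now apply cderiv_mult; eassumption.
Qed.

Lemma analytic_const (c : C) : analytic_on_disc (fun _ => c).
Proof. rewrite analytic_cderiv. intros. exists 0. apply cderiv_const. Qed.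

Lemma analytic_pow (n : nat) : analytic_on_disc (fun z => z ^ n)%C.
Proof. rewrite analytic_cderiv. intros. apply cderiv_pow. Qed.

Lemma analytic_bounded (f : C -> C) (r : R) : analytic_on_disc f -> r < 1 ->
  exists M, 0 <= M /\ forall z, Cmod z <= r -> Cmod (f z) <= M.
Proof.
intros Hf. destruct (analytic_has_psum f Hf) as [a Ha]. now apply (has_psum_bounded f a).
Qed.

(** * The Volterra operator *)

Lemma line_dist (z : C) (s t : R) : Cmod (RtoC s * z - RtoC t * z) = Rabs (s - t) * Cmod z.
Proof.
replace (RtoC s * z - RtoC t * z)%C with (RtoC (s - t) * z)%C by (rewrite RtoC_minus; ring).
now rewrite Cmod_mult, Cmod_R.
Qed.

Lemma ccont_line (k : C -> C) (z : C) (t : R) : ccont k (RtoC t * z)%C ->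
  forall eps, 0 < eps -> exists d, 0 < d /\ forall s, Rabs (s - t) < d ->
    Cmod (k (RtoC s * z) - k (RtoC t * z))%C < eps.
Proof.
intros H eps He. destruct (H eps He) as [d [Hd Hw]]. pose proof (Cmod_ge_0 z) as Pz.
exists (d / (Cmod z + 1)). split; [apply Rdiv_lt_0_compat; lra|].
intros s Hs. apply Hw. rewrite line_dist.
apply (Rmult_lt_compat_r (Cmod z + 1)) in Hs; [|lra].
replace (d / (Cmod z + 1) * (Cmod z + 1)) with d in Hs by (field; lra).
pose proof (Rabs_pos (s - t)). lra.
Qed.

Lemma cderiv_line (F : C -> C) (z l : C) (t : R) : cderiv F (RtoC t * z)%C l ->
  is_derive (fun t : R => fst (F (RtoC t * z)%C)) t (fst (l * z)%C) /\
  is_derive (fun t : R => snd (F (RtoC t * z)%C)) t (snd (l * z)%C).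
Proof.
intros H.
(* Both coordinates at once: [q] is any real-linear functional bounded by [Cmod]. *)
assert (forall q : C -> R, (forall x y, q (x - y)%C = q x - q y) ->
  (forall (c : R) x, q (RtoC c * x)%C = c * q x) -> (forall x, Rabs (q x) <= Cmod x) ->
  is_derive (fun t : R => q (F (RtoC t * z)%C)) t (q (l * z)%C)) as A.
{ intros q Q1 Q2 Q3. apply is_derive_Reals. intros eps He.
  pose proof (Cmod_ge_0 z) as Pz.
  destruct (H (eps / (2 * (Cmod z + 1)))) as [d [Hd Hw]]; [apply Rdiv_lt_0_compat; lra|].
  assert (0 < d / (Cmod z + 1)) as Pd by (apply Rdiv_lt_0_compat; lra).
  exists (mkposreal _ Pd). intros h Nh Hh. simpl in Hh.
  specialize (Hw (RtoC (t + h) * z)%C). rewrite line_dist in Hw.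
  replace (t + h - t) with h in Hw by ring.
  apply (Rmult_lt_compat_r (Cmod z + 1)) in Hh; [|lra].
  replace (d / (Cmod z + 1) * (Cmod z + 1)) with d in Hh by (field; lra).
  pose proof (Rabs_pos_lt h Nh) as Ph.
  specialize (Hw ltac:(lra)).
  replace (l * (RtoC (t + h) * z - RtoC t * z))%C with (RtoC h * (l * z))%C in Hw
    by (rewrite RtoC_plus; ring).
  set (X := (F (RtoC (t + h) * z) - F (RtoC t * z) - RtoC h * (l * z))%C) in *.
  replace ((q (F (RtoC (t + h) * z)%C) - q (F (RtoC t * z)%C)) / h - q (l * z)%C) with (q X / h).
  2:{ unfold X. rewrite 2!Q1, Q2. field. easy. }
  unfold Rdiv. rewrite Rabs_mult, Rabs_inv.
  apply (Rmult_lt_reg_r (Rabs h)); [easy|]. rewrite Rmult_assoc, Rinv_l, Rmult_1_r by lra.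
  eapply Rle_lt_trans; [apply Q3|]. eapply Rle_lt_trans; [apply Hw|].
  apply Rle_lt_trans with (eps / 2 * Rabs h).
  2:{ apply Rmult_lt_compat_r; lra. }
  replace (eps / (2 * (Cmod z + 1)) * (Rabs h * Cmod z))
    with (eps / 2 * Rabs h * (Cmod z / (Cmod z + 1))) by (field; lra).
  rewrite <- (Rmult_1_r (eps / 2 * Rabs h)) at 2.
  apply Rmult_le_compat_l; [apply Rmult_le_pos; lra|].
  apply (Rmult_le_reg_r (Cmod z + 1)); [lra|]. unfold Rdiv. rewrite Rmult_assoc, Rinv_l; lra. }
split; apply A.
- easy.
- intros c x. destruct x; simpl. ring.
- apply fst_le_Cmod.
- easy.
- intros c x. destruct x; simpl. ring.
- apply snd_le_Cmod.
Qed.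

Section Volterra.
Variable g : C -> C.
Hypothesis Hg : analytic_on_disc g.

Lemma disc_line (z : C) (t : R) : disc z -> 0 <= t <= 1 -> disc (RtoC t * z)%C.
Proof.
unfold disc. intros Hz Ht. rewrite Cmod_mult, Cmod_R, Rabs_pos_eq by lra.
pose proof (Cmod_ge_0 z). nra.
Qed.

Lemma V_op_is_RInt (f F : C -> C) (z : C) : analytic_on_disc f ->
  (forall w, disc w -> cderiv F w (f w * C_derive g w)%C) -> disc z ->
  is_RInt (V := C_R_NormedModule)
    (fun t : R => (f (RtoC t * z) * C_derive g (RtoC t * z) * z)%C) 0 1 (F z - F 0)%C.
Proof.
intros Hf HF Hz.
assert (forall w, disc w -> ccont (fun w => f w * C_derive g w * z)%C w) as Hc.
{ intros w Hw. apply ccont_mult.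
  - apply analytic_C_derive_analytic in Hg.
    pose proof (analytic_mult f _ Hf Hg) as A. rewrite analytic_cderiv in A.
    destruct (A w Hw) as [l Hl]. now apply cderiv_ccont in Hl.
  - apply (cderiv_ccont _ w 0), cderiv_const. }
assert ((F z - F 0)%C = (minus (fst (F (RtoC 1 * z)%C)) (fst (F (RtoC 0 * z)%C)) : R,
  minus (snd (F (RtoC 1 * z)%C)) (snd (F (RtoC 0 * z)%C)) : R)) as E.
{ rewrite Cmult_0_l, Cmult_1_l. easy. }
rewrite E. apply is_RInt_fct_extend_pair.
- apply (is_RInt_derive (V := R_CompleteNormedModule) (fun t => fst (F (RtoC t * z)%C)));
    intros t; rewrite Rmin_left, Rmax_right by lra; intros Ht.
  + apply (cderiv_line F z _ t), HF. now apply disc_line.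
  + apply eps_continuous. intros eps He.
    destruct (ccont_line _ z t (Hc _ (disc_line z t Hz Ht)) eps He) as [d [Hd Hw]].
    exists d; split; [easy|]. intros s Hs.
    eapply Rle_lt_trans; [|apply (Hw s Hs)]. apply (fst_le_Cmod (_ - _)%C).
- apply (is_RInt_derive (V := R_CompleteNormedModule) (fun t => snd (F (RtoC t * z)%C)));
    intros t; rewrite Rmin_left, Rmax_right by lra; intros Ht.
  + apply (cderiv_line F z _ t), HF. now apply disc_line.
  + apply eps_continuous. intros eps He.
    destruct (ccont_line _ z t (Hc _ (disc_line z t Hz Ht)) eps He) as [d [Hd Hw]].
    exists d; split; [easy|]. intros s Hs.
    eapply Rle_lt_trans; [|apply (Hw s Hs)]. apply (snd_le_Cmod (_ - _)%C).
Qed.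

Lemma V_op_primitive (f F : C -> C) (z : C) : analytic_on_disc f ->
  (forall w, disc w -> cderiv F w (f w * C_derive g w)%C) -> disc z ->
  V_op g f z = (F z - F 0)%C.
Proof.
intros Hf HF Hz. apply (is_RInt_unique (V := C_R_CompleteNormedModule)).
now apply V_op_is_RInt.
Qed.

Lemma has_psum_at_0 (f : C -> C) (a : nat -> C) : has_psum f a -> f 0 = a O.
Proof.
intros [_ Hf]. apply (csum_lim_unique (fun k => a k * 0 ^ k)%C).
- apply Hf. unfold disc. rewrite Cmod_0. lra.
- intros eps He. exists 1%nat. intros [|n] Hn; [lia|].
  rewrite csum_head.
  rewrite (csum_ext _ (fun _ => 0 * 0)%C) by (intros k; simpl; ring).
  rewrite (csum_scal 0 (fun _ => 0)). simpl.
  replace (a O * 1 + 0 * csum (fun _ => 0) n - a O)%C with (RtoC 0) by ring. now rewrite Cmod_0.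
Qed.

Lemma has_psum_ext (f : C -> C) (a b : nat -> C) : (forall n, a n = b n) ->
  has_psum f a -> has_psum f b.
Proof.
intros E [Ha Hf]. split.
- intros r Hr. apply (ex_series_ext (fun n => Cmod (a n) * r ^ n)); [|now apply Ha].
  intros n. now rewrite E.
- intros z Hz eps He. destruct (Hf z Hz eps He) as [N HN]. exists N. intros n Hn.
  rewrite <- (csum_ext (fun k => a k * z ^ k)%C); auto. intros k. now rewrite E.
Qed.

(** Termwise integration of the series of [f * C_derive g]: [G] has coefficients [c n / (n + 1)],
    and [w * G w] is the primitive vanishing at 0. On the disc [G] is [T_op g f], with the right
    value at 0 too. *)
Lemma V_op_factor (f : C -> C) : analytic_on_disc f -> exists G : C -> C,
  analytic_on_disc G /\ G 0 = (f 0 * C_derive g 0)%C /\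
  (forall z, disc z -> V_op g f z = (z * G z)%C) /\
  (forall z, disc z -> cderiv (fun w => w * G w)%C z (f z * C_derive g z)%C).
Proof.
intros Hf.
destruct (analytic_has_psum (fun z => f z * C_derive g z)%C) as [c Hc].
{ apply analytic_mult; [easy|now apply analytic_C_derive_analytic]. }
set (b := fun n => (RtoC (/ INR (S n)) * c n)%C).
assert (forall n, 0 < / INR (S n) <= 1) as Bn.
{ intros n. assert (1 <= INR (S n)) by (rewrite S_INR; generalize (pos_INR n); lra).
  split; [apply Rinv_0_lt_compat; lra|]. rewrite <- Rinv_1. apply Rinv_le_contravar; lra. }
assert (absc b) as Hb.
{ intros r Hr. apply (ex_series_le (V := R_CompleteNormedModule) _ (fun n => Cmod (c n) * r ^ n)).
  2:{ now apply Hc. }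
  intros n. change (norm ?x) with (Rabs x). assert (0 <= r ^ n) by (apply pow_le; lra).
  rewrite Rabs_pos_eq by (apply Rmult_le_pos; [apply Cmod_ge_0|easy]).
  apply Rmult_le_compat_r; [easy|]. unfold b. specialize (Bn n).
  rewrite Cmod_mult, Cmod_R, Rabs_pos_eq by lra. pose proof (Cmod_ge_0 (c n)). nra. }
destruct (absc_has_psum b Hb) as [G HG].
set (a := fun n => match n with O => RtoC 0 | S m => b m end).
assert (has_psum (fun w => w * G w)%C a) as Ha.
{ split.
  - intros r Hr. apply (ex_series_incr_1 (V := R_NormedModule)).
    apply (ex_series_ext (fun n => r * (Cmod (b n) * r ^ n))); [|now apply ex_series_scal_R, Hb].
    intros n. simpl. change ((r * (Cmod (b n) * r ^ n)) = Cmod (b n) * (r * r ^ n)). ring.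
  - intros z Hz eps He. destruct (proj2 HG z Hz eps He) as [N HN].
    exists (S N). intros [|n] Hn; [lia|]. rewrite csum_head.
    rewrite (csum_ext _ (fun k => z * (b k * z ^ k))%C) by (intros k; simpl; ring).
    rewrite csum_scal. simpl.
    replace (0 * 1 + z * csum (fun k => b k * z ^ k) n - z * G z)%C
      with (z * (csum (fun k => b k * z ^ k) n - G z))%C by ring.
    rewrite Cmod_mult. specialize (HN n ltac:(lia)). unfold disc in Hz.
    pose proof (Cmod_ge_0 z). pose proof (Cmod_ge_0 (csum (fun k => b k * z ^ k)%C n - G z)). nra. }
assert (forall z, disc z -> cderiv (fun w => w * G w)%C z (f z * C_derive g z)%C) as D.
{ apply (has_psum_cderiv _ (fun z => f z * C_derive g z)%C a Ha).
  apply (has_psum_ext _ c); [|easy]. intros n. unfold dcoef, a, b.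
  rewrite Cmult_assoc, <- RtoC_mult, Rinv_r, Cmult_1_l; [easy|]. apply not_0_INR. lia. }
exists G. split; [|split; [|split]].
- now apply has_psum_analytic with b.
- rewrite (has_psum_at_0 G b HG). unfold b. simpl. rewrite Rinv_1, Cmult_1_l.
  symmetry. now apply (has_psum_at_0 (fun z => f z * C_derive g z)%C).
- intros z Hz. rewrite (V_op_primitive f (fun w => w * G w)%C z Hf D Hz). ring.
- exact D.
Qed.

Lemma V_op_cderiv (f : C -> C) (z : C) : analytic_on_disc f -> disc z ->
  cderiv (V_op g f) z (f z * C_derive g z)%C.
Proof.
intros Hf Hz. destruct (V_op_factor f Hf) as [G [_ [_ [E D]]]].
apply (cderiv_ext_loc (fun w => w * G w)%C _ z _ (1 - Cmod z)); auto.
- unfold disc in Hz. lra.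
- intros w Hw. symmetry. apply E. unfold disc. pose proof (Cmod_le_sub w z). lra.
Qed.

Lemma V_op_0 (f : C -> C) : analytic_on_disc f -> V_op g f 0 = 0.
Proof.
intros Hf. destruct (V_op_factor f Hf) as [G [_ [_ [E _]]]].
rewrite E; [ring|]. unfold disc. rewrite Cmod_0. lra.
Qed.

Lemma V_op_analytic (f : C -> C) : analytic_on_disc f -> analytic_on_disc (V_op g f).
Proof.
intros Hf. apply analytic_cderiv. intros z Hz. eexists. now apply V_op_cderiv.
Qed.

Lemma V_op_plus (f h : C -> C) (z : C) : analytic_on_disc f -> analytic_on_disc h -> disc z ->
  V_op g (fun w => f w + h w)%C z = (V_op g f z + V_op g h z)%C.
Proof.
intros Hf Hh Hz. rewrite (V_op_primitive _ (fun w => V_op g f w + V_op g h w)%C).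
- rewrite 2!V_op_0 by easy. ring.
- now apply analytic_plus.
- intros w Hw. rewrite Cmult_plus_distr_r. apply cderiv_plus; now apply V_op_cderiv.
- easy.
Qed.

Lemma V_op_scal (c : C) (f : C -> C) (z : C) : analytic_on_disc f -> disc z ->
  V_op g (fun w => c * f w)%C z = (c * V_op g f z)%C.
Proof.
intros Hf Hz. rewrite (V_op_primitive _ (fun w => c * V_op g f w)%C).
- rewrite V_op_0 by easy. ring.
- apply analytic_mult; [apply analytic_const|easy].
- intros w Hw. rewrite <- Cmult_assoc. now apply cderiv_scal, V_op_cderiv.
- easy.
Qed.

(** The path is the segment from 0 to [z], which has length at most 1 and stays in [Cmod w <= r]. *)
Lemma V_op_bound (f : C -> C) (r M B : R) (z : C) : analytic_on_disc f -> disc z -> Cmod z <= r ->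
  (forall w, Cmod w <= r -> Cmod (f w) <= M) ->
  (forall w, Cmod w <= r -> Cmod (C_derive g w) <= B) ->
  Cmod (V_op g f z) <= M * B.
Proof.
intros Hf Hz Hr HM HB.
replace (V_op g f z) with (V_op g f z - V_op g f 0)%C by (rewrite V_op_0 by easy; ring).
rewrite Cmod_norm.
replace (M * B) with ((1 - 0) * (M * B)) by ring.
apply (norm_RInt_le_const (V := C_R_NormedModule)
  (fun t : R => (f (RtoC t * z) * C_derive g (RtoC t * z) * z)%C) 0 1 _ (M * B)); [lra| |].
- intros t Ht. rewrite <- Cmod_norm. unfold disc in Hz. pose proof (Cmod_ge_0 z) as Pz.
  assert (Cmod (RtoC t * z) <= r) as L.
  { rewrite Cmod_mult, Cmod_R, Rabs_pos_eq by lra. nra. }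
  rewrite 2!Cmod_mult. specialize (HM _ L). specialize (HB _ L).
  assert (Cmod (f (RtoC t * z)%C) * Cmod (C_derive g (RtoC t * z)%C) <= M * B)
    by (apply Rmult_le_compat; auto using Cmod_ge_0).
  assert (0 <= Cmod (f (RtoC t * z)%C) * Cmod (C_derive g (RtoC t * z)%C))
    by (apply Rmult_le_pos; apply Cmod_ge_0).
  nra.
- apply V_op_is_RInt; auto. intros w Hw. now apply V_op_cderiv.
Qed.

End Volterra.

(** * Bounds on circles and Hardy spaces *)

Lemma rpow_0 (s : R) : rpow 0 s = 0.
Proof. unfold rpow. now destruct (Req_dec_T 0 0). Qed.

Lemma rpow_pos_eq (x s : R) : 0 < x -> rpow x s = Rpower x s.
Proof. intros Hx. unfold rpow. destruct (Req_dec_T x 0); [lra|easy]. Qed.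

Lemma rpow_nonneg (x s : R) : 0 <= rpow x s.
Proof. unfold rpow. destruct (Req_dec_T x 0); [lra|]. left. apply exp_pos. Qed.

Lemma rpow_le (x y s : R) : 0 <= s -> 0 <= x -> x <= y -> rpow x s <= rpow y s.
Proof.
intros Hs Hx Hxy. destruct (Req_dec x 0) as [->|Nx]; [rewrite rpow_0; apply rpow_nonneg|].
rewrite 2!rpow_pos_eq by lra. apply Rle_Rpower_l; lra.
Qed.

Lemma rpow_mult (x y s : R) : 0 <= x -> 0 <= y -> rpow (x * y) s = rpow x s * rpow y s.
Proof.
intros Hx Hy.
destruct (Req_dec x 0) as [->|Nx]; [rewrite Rmult_0_l, rpow_0; ring|].
destruct (Req_dec y 0) as [->|Ny]; [rewrite Rmult_0_r, rpow_0; ring|].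
rewrite 3!rpow_pos_eq; try lra; [|apply Rmult_lt_0_compat; lra].
symmetry. apply Rpower_mult_distr; lra.
Qed.

Lemma rpow_rpow (x s t : R) : 0 <= x -> s * t = 1 -> rpow (rpow x s) t = x.
Proof.
intros Hx Hst. destruct (Req_dec x 0) as [->|Nx]; [now rewrite 2!rpow_0|].
rewrite (rpow_pos_eq x) by lra. rewrite rpow_pos_eq by apply exp_pos.
rewrite Rpower_mult, Hst. apply Rpower_1. lra.
Qed.

Lemma rpow_ge_id (x s : R) : 1 <= s -> 1 <= x -> x <= rpow x s.
Proof.
intros Hs Hx. rewrite rpow_pos_eq by lra. rewrite <- (Rpower_1 x) at 1 by lra.
now apply Rle_Rpower.
Qed.

(** The sum is at most twice the larger summand; this crude bound stands in for Minkowski's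
    inequality. *)
Lemma rpow_plus_le (x y s : R) : 1 <= s -> 0 <= x -> 0 <= y ->
  rpow (x + y) s <= rpow 2 s * (rpow x s + rpow y s).
Proof.
intros Hs Hx Hy.
pose proof (rpow_nonneg x s). pose proof (rpow_nonneg y s). pose proof (rpow_nonneg 2 s).
destruct (Rle_lt_dec x y).
- apply Rle_trans with (rpow (2 * y) s); [apply rpow_le; lra|].
  rewrite rpow_mult by lra. apply Rmult_le_compat_l; lra.
- apply Rle_trans with (rpow (2 * x) s); [apply rpow_le; lra|].
  rewrite rpow_mult by lra. apply Rmult_le_compat_l; lra.
Qed.

Lemma rpow_continuous (f : R -> R) (s t : R) : 0 < s -> (forall t, 0 <= f t) ->
  continuous f t -> continuous (fun t => rpow (f t) s) t.
Proof.
intros Hs Pf Hf. destruct (Req_dec (f t) 0) as [E|N].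
- apply eps_continuous. intros eps He.
  apply continuity_pt_filterlim in Hf.
  destruct (Hf (rpow eps (/ s))) as [d [Hd Hw]].
  { rewrite rpow_pos_eq by easy. apply exp_pos. }
  exists d; split; [easy|]. intros t' Ht. rewrite E, rpow_0, Rminus_0_r.
  rewrite Rabs_pos_eq by apply rpow_nonneg.
  destruct (Req_dec t' t) as [->|Nt]; [now rewrite E, rpow_0|].
  specialize (Hw t'). unfold dist in Hw. simpl in Hw. unfold R_dist in Hw.
  rewrite E, Rminus_0_r, (Rabs_pos_eq (f t')) in Hw by apply Pf.
  assert (f t' < rpow eps (/ s)) as L.
  { apply Hw. split; [|easy]. split; [exact I|auto]. }
  rewrite <- (rpow_rpow eps (/ s) s) by (try lra; field; lra).
  destruct (Req_dec (f t') 0) as [E'|N'].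
  + rewrite E', rpow_0. rewrite E' in L. rewrite rpow_pos_eq by easy. apply exp_pos.
  + pose proof (Pf t'). rewrite 2!(rpow_pos_eq _ s) by lra.
    apply Rlt_Rpower_l; lra.
- assert (0 < f t) as P by (generalize (Pf t); lra).
  apply (continuous_ext_loc _ (fun t => exp (s * ln (f t)))).
  + apply continuity_pt_filterlim in Hf.
    destruct (Hf (f t) P) as [d [Hd Hw]].
    exists (mkposreal d Hd). intros t' Ht.
    destruct (Req_dec t' t) as [->|Nt]; [now rewrite rpow_pos_eq|].
    specialize (Hw t'). unfold dist in Hw. simpl in Hw. unfold R_dist in Hw.
    assert (Rabs (f t' - f t) < f t) as L.
    { apply Hw. split; [|easy]. split; [exact I|auto]. }
    apply Rabs_def2 in L. rewrite rpow_pos_eq by lra. easy.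
  + apply (continuous_comp (fun t => s * ln (f t)) exp).
    * apply (continuous_scal_r (V := R_NormedModule) s (fun t => ln (f t))).
      apply (continuous_comp f ln); [easy|].
      apply continuity_pt_filterlim. apply derivable_continuous_pt.
      exists (/ f t). now apply derivable_pt_lim_ln.
    * apply continuity_pt_filterlim. apply derivable_continuous_pt, derivable_pt_exp.
Qed.

(* The [H^p] bound on a single circle. *)
Definition pb (p : Rbar) (u : R -> C) (M : R) : Prop :=
  match p with
  | Finite q => rpow (/ (2 * PI) * RInt (fun t => rpow (Cmod (u t)) q) 0 (2 * PI)) (/ q) <= M
  | p_infty => forall t, Cmod (u t) <= M
  | m_infty => False
  end.

Definition pint (q : R) (u : R -> C) : R := RInt (fun t => rpow (Cmod (u t)) q) 0 (2 * PI).

Lemma pint_continuous (q : R) (u : R -> C) (t : R) : 1 <= q -> pcont u ->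
  continuous (fun t => rpow (Cmod (u t)) q) t.
Proof.
intros Hq Hu. apply rpow_continuous; [lra| |now apply pcont_Cmod].
intros. apply Cmod_ge_0.
Qed.

Lemma is_RInt_pint (q : R) (u : R -> C) : 1 <= q -> pcont u ->
  is_RInt (fun t => rpow (Cmod (u t)) q) 0 (2 * PI) (pint q u).
Proof.
intros Hq Hu. apply (RInt_correct (V := R_CompleteNormedModule)).
apply (ex_RInt_continuous (V := R_CompleteNormedModule)). intros. now apply pint_continuous.
Qed.

Lemma pint_nonneg (q : R) (u : R -> C) : 1 <= q -> pcont u -> 0 <= pint q u.
Proof.
intros Hq Hu. apply RInt_ge_0.
- generalize PI_RGT_0; lra.
- eexists. now apply is_RInt_pint.
- intros. apply rpow_nonneg.
Qed.

(** Removing the root makes the bound one on an integral, to which linearity and monotonicity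
    apply. *)
Lemma pb_finite (q : R) (u : R -> C) (M : R) : 1 <= q -> pcont u -> 0 <= M ->
  pb q u M <-> pint q u <= 2 * PI * rpow M q.
Proof.
intros Hq Hu HM. unfold pb. fold (pint q u).
pose proof (pint_nonneg q u Hq Hu) as P. pose proof PI_RGT_0 as Ppi.
assert (0 <= / (2 * PI) * pint q u) as P'.
{ apply Rmult_le_pos; [|easy]. left. apply Rinv_0_lt_compat. lra. }
assert (0 < / q) by (apply Rinv_0_lt_compat; lra).
split; intros H0.
- apply (rpow_le _ _ q) in H0; [|lra|apply rpow_nonneg].
  rewrite rpow_rpow in H0 by (try easy; field; lra).
  apply (Rmult_le_compat_l (2 * PI)) in H0; [|lra].
  rewrite <- Rmult_assoc, Rinv_r, Rmult_1_l in H0 by lra. easy.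
- rewrite <- (rpow_rpow M q (/ q)) by (try easy; field; lra).
  apply rpow_le; [lra|easy|].
  apply (Rmult_le_reg_l (2 * PI)); [lra|].
  rewrite <- Rmult_assoc, Rinv_r, Rmult_1_l by lra. easy.
Qed.

Lemma pb_le (p : Rbar) (u : R -> C) (M M' : R) : pb p u M -> M <= M' -> pb p u M'.
Proof.
destruct p as [q| |]; simpl; intros H L; [lra| |easy]. intros t. specialize (H t). lra.
Qed.

(** Besides comparison, this is the means of replacing a path by a pointwise equal one. *)
Lemma pb_dom (p : Rbar) (u v : R -> C) (M : R) : Rbar_le 1 p -> pcont u -> pcont v -> 0 <= M ->
  (forall t, Cmod (u t) <= Cmod (v t)) -> pb p v M -> pb p u M.
Proof.
intros Hp Hu Hv HM D. destruct p as [q| |]; [|intros H t; specialize (D t); specialize (H t); lra|easy].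
simpl in Hp. rewrite 2!pb_finite by easy. intros H.
eapply Rle_trans; [|apply H]. unfold pint. apply RInt_le.
- generalize PI_RGT_0; lra.
- eexists. now apply is_RInt_pint.
- eexists. now apply is_RInt_pint.
- intros. apply rpow_le; [lra|apply Cmod_ge_0|apply D].
Qed.

Lemma pb_const (p : Rbar) (u : R -> C) (M : R) : Rbar_le 1 p -> pcont u -> 0 <= M ->
  (forall t, Cmod (u t) <= M) -> pb p u M.
Proof.
intros Hp Hu HM D. apply (pb_dom p u (fun _ => RtoC M)); auto using pcont_const.
- intros t. rewrite Cmod_R, Rabs_pos_eq; auto.
- destruct p as [q| |]; [| |easy].
  + apply pb_finite; auto using pcont_const. unfold pint.
    rewrite RInt_const, Cmod_R, Rabs_pos_eq by easy.
    change (scal ?x ?y) with (x * y). right. ring.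
  + intros t. rewrite Cmod_R, Rabs_pos_eq; auto. lra.
Qed.

(** One factor 2 comes from [rpow_plus_le]; the other absorbs the two integrals, through
    [2 <= rpow 2 q]. *)
Lemma pb_plus (p : Rbar) (u v : R -> C) (M1 M2 : R) : Rbar_le 1 p -> pcont u -> pcont v ->
  0 <= M1 -> 0 <= M2 -> pb p u M1 -> pb p v M2 -> pb p (fun t => u t + v t)%C (4 * (M1 + M2)).
Proof.
intros Hp Hu Hv P1 P2 H1 H2. destruct p as [q| |]; [| |easy].
2:{ intros t. eapply Rle_trans; [apply Cmod_triangle|]. specialize (H1 t). specialize (H2 t). lra. }
simpl in Hp.
apply pb_finite in H1, H2; try easy. apply pb_finite; auto using pcont_plus; [lra|].
apply Rle_trans with (rpow 2 q * (pint q u + pint q v)).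
- assert (is_RInt (fun t => rpow 2 q * (rpow (Cmod (u t)) q + rpow (Cmod (v t)) q)) 0 (2 * PI)
    (rpow 2 q * (pint q u + pint q v))) as I.
  { apply (is_RInt_scal (V := R_NormedModule)), (is_RInt_plus (V := R_NormedModule));
      now apply is_RInt_pint. }
  rewrite <- (is_RInt_unique _ _ _ _ I). unfold pint. apply RInt_le.
  + generalize PI_RGT_0; lra.
  + eexists. apply is_RInt_pint; auto using pcont_plus.
  + eexists. apply I.
  + intros t _. eapply Rle_trans; [|apply rpow_plus_le; auto using Cmod_ge_0].
    apply rpow_le; [lra|apply Cmod_ge_0|apply Cmod_triangle].
- pose proof PI_RGT_0 as Ppi. pose proof (rpow_nonneg 2 q) as P2q.
  pose proof (rpow_nonneg (M1 + M2) q) as PM.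
  assert (rpow M1 q <= rpow (M1 + M2) q) by (apply rpow_le; lra).
  assert (rpow M2 q <= rpow (M1 + M2) q) by (apply rpow_le; lra).
  replace (4 * (M1 + M2)) with (2 * (2 * (M1 + M2))) by ring.
  rewrite 2!rpow_mult by lra.
  assert (2 <= rpow 2 q) as L2 by (apply rpow_ge_id; lra).
  set (A := rpow 2 q) in *. set (B := rpow (M1 + M2) q) in *.
  assert (pint q u <= 2 * PI * B).
  { eapply Rle_trans; [apply H1|]. apply Rmult_le_compat_l; lra. }
  assert (pint q v <= 2 * PI * B).
  { eapply Rle_trans; [apply H2|]. apply Rmult_le_compat_l; lra. }
  replace (2 * PI * (A * (A * B))) with (A * (A * (2 * PI * B))) by ring.
  apply Rmult_le_compat_l; [easy|].
  assert (0 <= 2 * PI * B) by (apply Rmult_le_pos; lra).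
  assert (2 * (2 * PI * B) <= A * (2 * PI * B)) by (apply Rmult_le_compat_r; lra). lra.
Qed.

Lemma pb_scal (p : Rbar) (u : R -> C) (c : C) (M : R) : Rbar_le 1 p -> pcont u -> 0 <= M ->
  pb p u M -> pb p (fun t => c * u t)%C (Cmod c * M).
Proof.
intros Hp Hu HM H. pose proof (Cmod_ge_0 c) as Pc. destruct p as [q| |]; [| |easy].
2:{ intros t. rewrite Cmod_mult. apply Rmult_le_compat_l; auto. }
simpl in Hp. apply pb_finite in H; try easy.
apply pb_finite; auto using pcont_scal; [now apply Rmult_le_pos|].
assert (is_RInt (fun t => rpow (Cmod c) q * rpow (Cmod (u t)) q) 0 (2 * PI)
  (rpow (Cmod c) q * pint q u)) as I.
{ apply (is_RInt_scal (V := R_NormedModule)). now apply is_RInt_pint. }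
unfold pint. rewrite (RInt_ext _ (fun t => rpow (Cmod c) q * rpow (Cmod (u t)) q)).
2:{ intros. rewrite Cmod_mult. apply rpow_mult; auto using Cmod_ge_0. }
rewrite (is_RInt_unique _ _ _ _ I), rpow_mult by easy.
replace (2 * PI * (rpow (Cmod c) q * rpow M q)) with (rpow (Cmod c) q * (2 * PI * rpow M q)) by ring.
apply Rmult_le_compat_l; [apply rpow_nonneg|easy].
Qed.

(* For finite [q] this integrates [x <= M (1 + (x / M)^q)], a crude form of Jensen's inequality. *)
Lemma pb_cint (p : Rbar) (u v : R -> C) (M : R) : Rbar_le 1 p -> pcont u -> pcont v -> 0 < M ->
  (forall t, Cmod (v t) <= Cmod (u t)) -> pb p u M -> Cmod (cint v) <= 4 * PI * M.
Proof.
intros Hp Hu Hv HM D H. pose proof PI_RGT_0 as Ppi. destruct p as [q| |]; [| |easy].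
2:{ apply Rle_trans with (2 * PI * M); [|nra]. apply cint_norm_le_const; [easy|].
    intros t _. specialize (D t). specialize (H t). lra. }
simpl in Hp.
assert (0 < / M) as PM by now apply Rinv_0_lt_compat.
set (w := fun t => (RtoC (/ M) * u t)%C).
assert (pcont w) as Hw by now apply pcont_scal.
assert (pb q w 1) as H1.
{ replace 1 with (Cmod (RtoC (/ M)) * M).
  - apply pb_scal; auto. lra.
  - rewrite Cmod_R, Rabs_pos_eq by lra. field. lra. }
apply pb_finite in H1; try easy; try lra.
replace (rpow 1 q) with 1 in H1 by (rewrite rpow_pos_eq by lra; unfold Rpower; now rewrite ln_1, Rmult_0_r, exp_0).
assert (is_RInt (fun t => M * (1 + rpow (Cmod (w t)) q)) 0 (2 * PI)
  (M * ((2 * PI - 0) * 1 + pint q w))) as I.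
{ apply (is_RInt_scal (V := R_NormedModule)), (is_RInt_plus (V := R_NormedModule)).
  - apply (is_RInt_const (V := R_NormedModule)).
  - now apply is_RInt_pint. }
apply Rle_trans with (M * ((2 * PI - 0) * 1 + pint q w)).
2:{ replace (4 * PI * M) with (M * (4 * PI)) by ring. apply Rmult_le_compat_l; lra. }
rewrite <- (is_RInt_unique _ _ _ _ I). apply cint_norm_le; [easy| |].
- intros t. apply (continuous_scal_r (V := R_NormedModule) M (fun t => 1 + rpow (Cmod (w t)) q)).
  apply (continuous_plus (V := R_NormedModule) (fun _ => 1)); [apply continuous_const|].
  now apply pint_continuous.
- intros t _. eapply Rle_trans; [apply D|].
  replace (Cmod (u t)) with (M * Cmod (w t)).
  2:{ unfold w. rewrite Cmod_mult, Cmod_R, Rabs_pos_eq by lra. field. lra. }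
  apply Rmult_le_compat_l; [lra|]. pose proof (rpow_nonneg (Cmod (w t)) q).
  destruct (Rle_lt_dec (Cmod (w t)) 1); [lra|].
  pose proof (rpow_ge_id (Cmod (w t)) q Hp ltac:(lra)). lra.
Qed.

(** Serves [p_infty], where the norm ranges over points of the disc while [pb] ranges over
    circles. *)
Lemma polar_form (z : C) : exists t, z = circle_point (Cmod z) t.
Proof.
destruct (Req_dec (Cmod z) 0) as [E|N].
{ exists 0. rewrite E. apply Cmod_eq_0 in E. rewrite E. unfold circle_point, RtoC. f_equal; ring. }
set (m := Cmod z) in *. pose proof (Cmod_ge_0 z) as P. fold m in P.
destruct z as [x y].
assert (x * x + y * y = m * m) as E.
{ unfold m, Cmod. cbn [fst snd]. rewrite sqrt_sqrt; nra. }
assert (-1 <= x / m <= 1) as B.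
{ assert (Rabs x <= m) as A by apply (fst_le_Cmod (x, y)). apply Rabs_le_between in A.
  split; apply (Rmult_le_reg_r m); try lra; unfold Rdiv; rewrite Rmult_assoc, Rinv_l; lra. }
assert (sqrt (1 - Rsqr (x / m)) = Rabs y / m) as S.
{ replace (1 - Rsqr (x / m)) with (Rsqr (Rabs y / m)).
  - apply sqrt_Rsqr. apply Rdiv_le_0_compat; [apply Rabs_pos|lra].
  - unfold Rsqr. replace (Rabs y / m * (Rabs y / m)) with (Rabs y * Rabs y / (m * m)) by (field; lra).
    replace (Rabs y * Rabs y) with (y * y) by (rewrite <- Rabs_mult; symmetry; apply Rabs_pos_eq, Rle_0_sqr).
    replace (y * y) with (m * m - x * x) by lra. field. lra. }
destruct (Rle_lt_dec 0 y) as [Py|Ny].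
- exists (acos (x / m)). unfold circle_point. rewrite cos_acos, sin_acos, S by easy.
  rewrite Rabs_pos_eq by easy. f_equal; field; lra.
- exists (- acos (x / m)). unfold circle_point. rewrite cos_neg, sin_neg, cos_acos, sin_acos, S by easy.
  rewrite Rabs_left by easy. f_equal; field; lra.
Qed.

Lemma hardy_norm_le (p : Rbar) (f : C -> C) (M : R) : Rbar_le 1 p ->
  Rbar_le (hardy_norm p f) M <->
  forall r, 0 <= r < 1 -> pb p (fun t => f (circle_point r t)) M.
Proof.
intros Hp. destruct p as [q| |]; [| |easy]; unfold hardy_norm.
- destruct (Lub_Rbar_correct (fun x => exists r, 0 <= r < 1 /\ x = circle_mean q r f)) as [U L].
  split; intros H.
  + intros r Hr. specialize (U (circle_mean q r f) (ex_intro _ r (conj Hr eq_refl))).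
    exact (Rbar_le_trans _ _ _ U H).
  + apply L. intros x [r [Hr ->]]. exact (H r Hr).
- destruct (Lub_Rbar_correct (fun x => exists z, disc z /\ x = Cmod (f z))) as [U L].
  split; intros H.
  + intros r Hr t. apply (Rbar_le_trans (Finite (Cmod (f (circle_point r t)))) _ (Finite M)) in H; [exact H|].
    apply U. exists (circle_point r t). split; [|easy].
    unfold disc. rewrite Cmod_circle_point, Rabs_pos_eq; lra.
  + apply L. intros x [z [Hz ->]]. destruct (polar_form z) as [t Ht]. rewrite Ht.
    apply (H (Cmod z)). split; [apply Cmod_ge_0|exact Hz].
Qed.

Lemma hardy_iff (p : Rbar) (f : C -> C) : Rbar_le 1 p -> hardy p f <->
  analytic_on_disc f /\ exists M, 0 <= M /\
    forall r, 0 <= r < 1 -> pb p (fun t => f (circle_point r t)) M.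
Proof.
intros Hp. unfold hardy. split; intros [A H]; (split; [easy|]).
- assert (exists M, Rbar_le (hardy_norm p f) (Finite M)) as [M HM].
  { destruct (hardy_norm p f) as [x| |]; [exists x; apply Rle_refl|easy|now exists 0]. }
  exists (Rmax 0 M). split; [apply Rmax_l|]. intros r Hr.
  apply pb_le with M; [|apply Rmax_r]. now apply hardy_norm_le.
- destruct H as [M [_ HM]]. apply Rbar_le_lt_trans with (Finite M); [|easy].
  now apply hardy_norm_le.
Qed.

Lemma analytic_pcont (f : C -> C) (r : R) : analytic_on_disc f -> 0 <= r < 1 ->
  pcont (fun t => f (circle_point r t)).
Proof.
intros Hf Hr. apply pcont_circle. intros t.
destruct (proj1 (analytic_cderiv f) Hf (circle_point r t)) as [l Hl].
- unfold disc. rewrite Cmod_circle_point, Rabs_pos_eq; lra.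
- now apply cderiv_ccont in Hl.
Qed.

Lemma hardy_ext (p : Rbar) (f h : C -> C) : Rbar_le 1 p -> (forall z, disc z -> f z = h z) ->
  hardy p f -> hardy p h.
Proof.
intros Hp E. rewrite 2!hardy_iff by easy. intros [A [M [PM HM]]].
pose proof (analytic_ext f h E A) as A'. split; [easy|].
exists M. split; [easy|]. intros r Hr.
apply (pb_dom p _ (fun t => f (circle_point r t))); auto using analytic_pcont.
intros t. rewrite E; [lra|]. unfold disc. rewrite Cmod_circle_point, Rabs_pos_eq; lra.
Qed.

Lemma hardy_linear (p : Rbar) : Rbar_le 1 p -> linear_subspace (hardy p).
Proof.
intros Hp. split; [|split].
- apply hardy_iff; [easy|]. split; [apply analytic_const|]. exists 0. split; [lra|].
  intros r Hr. apply pb_const; auto using pcont_const; [lra|]. intros. rewrite Cmod_0. lra.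
- intros f h. rewrite 3!hardy_iff by easy. intros [Af [M1 [P1 H1]]] [Ah [M2 [P2 H2]]].
  split; [now apply analytic_plus|]. exists (4 * (M1 + M2)). split; [lra|].
  intros r Hr. apply (pb_plus p (fun t => f (circle_point r t)) (fun t => h (circle_point r t)));
    auto using analytic_pcont.
- intros c f. rewrite 2!hardy_iff by easy. intros [Af [M [P H]]].
  split; [apply analytic_mult; [apply analytic_const|easy]|].
  exists (Cmod c * M). split; [apply Rmult_le_pos; [apply Cmod_ge_0|easy]|].
  intros r Hr. apply (pb_scal p (fun t => f (circle_point r t))); auto using analytic_pcont.
Qed.

(** * Lacunary series *)

Lemma has_psum_shift (f : C -> C) (a : nat -> C) : has_psum f a ->
  exists f1, has_psum f1 (fun n => a (S n)) /\ forall z, disc z -> f z = (a O + z * f1 z)%C.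
Proof.
intros [Ha Hf].
assert (absc (fun n => a (S n))) as Hs.
{ intros r Hr. set (s := (1 + r) / 2). assert (r < s < 1) as Ls by (unfold s; lra).
  apply (ex_series_le (V := R_CompleteNormedModule) _ (fun n => / s * (Cmod (a (S n)) * s ^ S n))).
  - intros n. change (norm ?x) with (Rabs x).
    rewrite Rabs_pos_eq by (apply Rmult_le_pos; [apply Cmod_ge_0|apply pow_le; lra]).
    replace (/ s * (Cmod (a (S n)) * s ^ S n)) with (Cmod (a (S n)) * s ^ n) by (simpl; field; lra).
    apply Rmult_le_compat_l; [apply Cmod_ge_0|]. apply pow_incr. lra.
  - apply ex_series_scal_R.
    apply (ex_series_incr_1 (V := R_NormedModule) (fun n => Cmod (a n) * s ^ n)). apply Ha. lra. }
destruct (absc_has_psum _ Hs) as [f1 Hf1]. exists f1. split; [easy|].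
intros z Hz. apply (csum_lim_unique (fun k => a k * z ^ k)%C); [now apply Hf|].
intros eps He. destruct (proj2 Hf1 z Hz eps He) as [N HN].
exists (S N). intros [|n] Hn; [lia|]. rewrite csum_head.
rewrite (csum_ext _ (fun k => z * (a (S k) * z ^ k))%C) by (intros k; simpl; ring).
rewrite csum_scal. simpl.
replace (a O * 1 + z * csum (fun k => a (S k) * z ^ k) n - (a O + z * f1 z))%C
  with (z * (csum (fun k => a (S k) * z ^ k) n - f1 z))%C by ring.
rewrite Cmod_mult. specialize (HN n ltac:(lia)). unfold disc in Hz.
pose proof (Cmod_ge_0 z). pose proof (Cmod_ge_0 (csum (fun k => a (S k) * z ^ k)%C n - f1 z)). nra.
Qed.

Lemma has_psum_ccont (f : C -> C) (a : nat -> C) (z : C) : has_psum f a -> disc z -> ccont f z.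
Proof.
intros Hf Hz. apply has_psum_analytic in Hf. rewrite analytic_cderiv in Hf.
destruct (Hf z Hz) as [l Hl]. now apply cderiv_ccont in Hl.
Qed.

(** Agreement is required only off 0, so that the hypothesis survives division by [z] in the
    induction; the constant terms agree by continuity at 0. *)
Lemma has_psum_unique (n : nat) : forall (f h : C -> C) (a b : nat -> C),
  has_psum f a -> has_psum h b -> (forall z, disc z -> z <> 0 -> f z = h z) -> a n = b n.
Proof.
assert (disc 0) as D0 by (unfold disc; rewrite Cmod_0; lra).
assert (forall (f h : C -> C) (a b : nat -> C), has_psum f a -> has_psum h b ->
  (forall z, disc z -> z <> 0 -> f z = h z) -> a O = b O) as B.
{ intros f h a b Hf Hh E. rewrite <- (has_psum_at_0 f a Hf), <- (has_psum_at_0 h b Hh).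
  apply NNPP. intros N.
  assert (0 < Cmod (f 0 - h 0)) as P.
  { apply Cmod_gt_0. intros E0. apply N. replace (f 0) with ((f 0 - h 0) + h 0)%C by ring.
    rewrite E0. ring. }
  destruct (has_psum_ccont f a 0 Hf D0 (Cmod (f 0 - h 0) / 2)) as [d1 [P1 H1]]; [lra|].
  destruct (has_psum_ccont h b 0 Hh D0 (Cmod (f 0 - h 0) / 2)) as [d2 [P2 H2]]; [lra|].
  set (x := Rmin (1 / 2) (Rmin (d1 / 2) (d2 / 2))).
  assert (0 < x) as Px by (repeat apply Rmin_pos; lra).
  assert (x <= 1 / 2) by apply Rmin_l.
  assert (x <= d1 / 2) by (eapply Rle_trans; [apply Rmin_r|apply Rmin_l]).
  assert (x <= d2 / 2) by (eapply Rle_trans; [apply Rmin_r|apply Rmin_r]).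
  assert (Cmod (RtoC x) = x) as Ex by (rewrite Cmod_R, Rabs_pos_eq; lra).
  assert (Cmod (RtoC x - 0) = x) as Ex' by (rewrite <- Ex at 2; f_equal; ring).
  specialize (H1 (RtoC x) ltac:(lra)). specialize (H2 (RtoC x) ltac:(lra)).
  rewrite E in H1.
  - pose proof (Cmod_triangle_sub (f 0) (h (RtoC x)) (h 0)) as T.
    rewrite (Cmod_minus_sym (f 0) (h (RtoC x))) in T. lra.
  - unfold disc. lra.
  - apply Cmod_gt_0. lra. }
induction n as [|n IH]; [exact B|].
intros f h a b Hf Hh E.
destruct (has_psum_shift f a Hf) as [f1 [F1 F2]]. destruct (has_psum_shift h b Hh) as [h1 [H1 H2]].
apply (IH f1 h1 (fun n => a (S n)) (fun n => b (S n)) F1 H1).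
intros z Hz Nz. pose proof (E z Hz Nz) as Ez. rewrite F2, H2, (B f h a b Hf Hh E) in Ez by easy.
replace (f1 z) with (/ z * ((b O + z * f1 z) - b O))%C by (field; easy).
rewrite Ez. field. easy.
Qed.

Lemma one_minus_pow_le (r : R) (n : nat) : 0 <= r <= 1 -> 1 - r ^ n <= INR n * (1 - r).
Proof.
intros Hr. induction n as [|n IH]; [simpl; lra|].
rewrite S_INR. simpl.
assert (0 <= r ^ n <= 1) by (split; [apply pow_le; lra|rewrite <- (pow1 n); apply pow_incr; lra]).
assert (r ^ n * (1 - r) <= 1 * (1 - r)) by (apply Rmult_le_compat_r; lra). lra.
Qed.

(** On a circle of radius [r] the function [r ^ n * f w * (/ w) ^ n] has the modulus of [f], so the
    [H^p] bound controls [r ^ n] times the [n]-th coefficient. *)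
Lemma hardy_coef_bounded (p : Rbar) (f : C -> C) (a : nat -> C) : Rbar_le 1 p ->
  hardy p f -> has_psum f a -> exists M, forall n, Cmod (a n) <= M.
Proof.
intros Hp Hf Ha. apply hardy_iff in Hf; [|easy]. destruct Hf as [Af [M0 [PM0 HM0]]].
set (M := M0 + 1). exists (4 * M). intros n.
assert (has_psum f (taylor_coef f)) as Ht.
{ split; [now apply absc_taylor_coef|]. intros z. now apply taylor_expansion. }
rewrite (has_psum_unique n f f a (taylor_coef f)) by easy.
(* The radius depends on [n] so that [r ^ n >= 1 / 2] by Bernoulli's inequality. *)
set (r := 1 - / (2 * INR (S n))).
assert (1 <= INR (S n)) as L1 by (rewrite S_INR; generalize (pos_INR n); lra).
assert (0 < / (2 * INR (S n)) <= 1 / 2) as Lr.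
{ split; [apply Rinv_0_lt_compat; lra|]. replace (1 / 2) with (/ 2) by field.
  apply Rinv_le_contravar; lra. }
assert (1 / 2 <= r < 1) as Hr by (unfold r; lra).
assert (1 / 2 <= r ^ n) as Hrn.
{ pose proof (one_minus_pow_le r n ltac:(lra)) as T.
  assert (INR n * (1 - r) <= 1 / 2); [|lra].
  apply Rle_trans with (INR (S n) * (1 - r)).
  - apply Rmult_le_compat_r; [lra|]. rewrite S_INR. lra.
  - unfold r. right. field. lra. }
pose proof PI_RGT_0 as Ppi.
assert (Cmod (RtoC (r ^ n) * circ_int r (fun w => f w * (/ w) ^ n)%C) <= 4 * PI * M) as K.
{ unfold circ_int. rewrite <- cint_scal by (apply taylor_integrand_pcont; [easy|lra]).
  apply (pb_cint p (fun t => f (circle_point r t))); auto.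
  - apply analytic_pcont; [easy|lra].
  - apply pcont_scal, taylor_integrand_pcont; [easy|lra].
  - unfold M. lra.
  - intros t. rewrite 2!Cmod_mult, Cmod_pow, Cmod_inv by (apply circle_point_neq_0; lra).
    rewrite Cmod_circle_point, Cmod_R, (Rabs_pos_eq r), Rabs_pos_eq by (try apply pow_le; lra).
    rewrite pow_inv. right. field. lra.
  - apply pb_le with M0; [apply HM0; lra|unfold M; lra]. }
rewrite taylor_coef_circ_int, 2!Cmod_mult, 2!Cmod_R in K by (try easy; lra).
rewrite 2!Rabs_pos_eq in K by lra.
pose proof (Cmod_ge_0 (taylor_coef f n)) as Pt.
apply (Rmult_le_reg_l PI); [lra|].
assert (1 / 2 * (2 * PI * Cmod (taylor_coef f n)) <= r ^ n * (2 * PI * Cmod (taylor_coef f n)))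
  by (apply Rmult_le_compat_r; [apply Rmult_le_pos|]; lra). lra.
Qed.

(** * Optimal domains of [V_g] and [T_g] *)

Section Main.
Variables (p : Rbar) (g : C -> C).
Hypothesis hp : Rbar_le 1 p.
Hypothesis hg : analytic_on_disc g.

Lemma circle_point_disc (r t : R) : 0 <= r < 1 -> disc (circle_point r t).
Proof. intros. unfold disc. rewrite Cmod_circle_point, Rabs_pos_eq; lra. Qed.

(** Multiplication by [z] does not increase the modulus on the disc. Division by [z] at most doubles
    it where [Cmod z > 1 / 2], and on the smaller circles [G] is bounded, being analytic. *)
Lemma hardy_V_op_T_op (f : C -> C) : analytic_on_disc f ->
  hardy p (V_op g f) <-> hardy p (T_op g f).
Proof.
intros Hf. destruct (V_op_factor g hg f Hf) as [G [AG [G0 [EG _]]]].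
assert (forall z, disc z -> G z = T_op g f z) as ET.
{ intros z Hz. unfold T_op. destruct (Ceq_dec z 0) as [->|N]; [easy|].
  rewrite EG by easy. field. easy. }
pose proof (V_op_analytic g hg f Hf) as AV.
split; intros H.
- apply (hardy_ext p G); auto. apply hardy_iff in H; [|easy]. destruct H as [_ [M [PM HM]]].
  apply hardy_iff; [easy|]. split; [easy|].
  destruct (analytic_bounded G (1 / 2) AG ltac:(lra)) as [B [PB HB]].
  exists (2 * M + B). split; [lra|]. intros r Hr. pose proof (analytic_pcont G r AG Hr) as PC.
  destruct (Rle_lt_dec r (1 / 2)).
  + apply pb_const; auto; [lra|]. intros t. apply Rle_trans with B; [|lra]. apply HB.
    rewrite Cmod_circle_point, Rabs_pos_eq; lra.
  + apply (pb_dom p _ (fun t => RtoC 2 * V_op g f (circle_point r t))%C); auto.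
    * apply (pcont_scal 2), (analytic_pcont _ r AV Hr).
    * lra.
    * intros t. rewrite EG by now apply circle_point_disc.
      rewrite 2!Cmod_mult, Cmod_circle_point, Cmod_R, (Rabs_pos_eq r), Rabs_pos_eq by lra.
      pose proof (Cmod_ge_0 (G (circle_point r t))). nra.
    * apply pb_le with (Cmod 2 * M).
      -- apply (pb_scal p (fun t => V_op g f (circle_point r t))); auto.
         now apply analytic_pcont.
      -- rewrite Cmod_R, Rabs_pos_eq by lra. lra.
- apply (hardy_ext p (T_op g f) G) in H; auto.
  2:{ intros z Hz. symmetry. now apply ET. }
  apply hardy_iff in H; [|easy]. destruct H as [_ [M [PM HM]]].
  apply hardy_iff; [easy|]. split; [easy|]. exists M. split; [easy|]. intros r Hr.
  apply (pb_dom p _ (fun t => G (circle_point r t))); auto using analytic_pcont.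
  intros t. rewrite EG by now apply circle_point_disc.
  rewrite Cmod_mult, Cmod_circle_point, Rabs_pos_eq by lra.
  pose proof (Cmod_ge_0 (G (circle_point r t))). nra.
Qed.

Lemma optimal_domain_linear : linear_subspace (optimal_domain (V_op g) (hardy p)).
Proof.
destruct (hardy_linear p hp) as [L1 [L2 L3]]. split; [|split].
- split; [apply analytic_const|]. apply (hardy_ext p (fun _ => RtoC 0)); auto.
  intros z Hz. rewrite (V_op_primitive g hg (fun _ => RtoC 0) (fun _ => RtoC 0)); auto.
  + ring.
  + apply analytic_const.
  + intros w Hw. rewrite Cmult_0_l. apply cderiv_const.
- intros f h [Af Hf] [Ah Hh]. split; [now apply analytic_plus|].
  apply (hardy_ext p (fun z => V_op g f z + V_op g h z)%C); auto.
  intros z Hz. now rewrite V_op_plus.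
- intros c f [Af Hf]. split; [apply analytic_mult; [apply analytic_const|easy]|].
  apply (hardy_ext p (fun z => c * V_op g f z)%C); auto.
  intros z Hz. now rewrite V_op_scal.
Qed.

(** * Monomials and the greedy lacunary series *)

Definition monomial (n : nat) : C -> C := fun z => (z ^ n)%C.

Lemma pb_monomial (n : nat) (r : R) : 0 <= r < 1 -> pb p (fun t => monomial n (circle_point r t)) 1.
Proof.
intros Hr. apply pb_const; auto; [apply (analytic_pcont (monomial n) r (analytic_pow n) Hr)|lra|].
intros t. unfold monomial. rewrite Cmod_pow, Cmod_circle_point, Rabs_pos_eq by lra.
rewrite <- (pow1 n). apply pow_incr. lra.
Qed.

Lemma V_op_monomial_small (r eps : R) : 0 <= r < 1 -> 0 < eps ->
  exists N, forall n t, (N <= n)%nat -> Cmod (V_op g (monomial n) (circle_point r t)) <= eps.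
Proof.
intros Hr He.
destruct (analytic_bounded (C_derive g) r (analytic_C_derive_analytic g hg) ltac:(lra)) as [B [PB HB]].
destruct (pow_lt_1_zero r) with (y := eps / (B + 1)) as [N HN].
{ rewrite Rabs_pos_eq; lra. } { apply Rdiv_lt_0_compat; lra. }
exists N. intros n t Hn. specialize (HN n Hn).
assert (0 <= r ^ n) as Prn by (apply pow_le; lra). rewrite Rabs_pos_eq in HN by easy.
apply Rle_trans with (r ^ n * B).
- apply (V_op_bound g hg (monomial n) r); auto using circle_point_disc.
  + apply analytic_pow.
  + rewrite Cmod_circle_point, Rabs_pos_eq; lra.
  + intros w Hw. unfold monomial. rewrite Cmod_pow. apply pow_incr. split; [apply Cmod_ge_0|easy].
- apply (Rmult_lt_compat_r (B + 1)) in HN; [|lra].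
  replace (eps / (B + 1) * (B + 1)) with eps in HN by (field; lra). lra.
Qed.

Definition small (n : nat) (eps : R) : Prop :=
  forall r, 0 <= r < 1 -> pb p (fun t => V_op g (monomial n) (circle_point r t)) eps.

(* On each circle [V z^n] tends to [0] uniformly, so the limit provided by
   compactness has arbitrarily small norm. *)
Lemma compact_small (hc : compact_operator (hardy p) (hardy_norm p) (V_op g)) (eps : R) (N : nat) :
  0 < eps -> exists n, (N <= n)%nat /\ small n eps.
Proof.
intros He. destruct hc as [_ Hc].
destruct (Hc monomial) as [phi [h [Hphi [Hh Hlim]]]].
{ intros n. apply hardy_iff; [easy|]. split; [apply analytic_pow|].
  exists 1. split; [lra|]. intros r Hr. now apply pb_monomial. }
{ exists 1. intros n. apply hardy_norm_le; [easy|]. intros r Hr. now apply pb_monomial. }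
(* Two uses of [pb_plus]: the limit [h] gets [4 * (eta + eta) = 8 * eta], then [V z^n] gets
   [4 * (eta + 8 * eta) = 36 * eta]. *)
set (eta := eps / 36). assert (0 < eta) as Pe by (unfold eta; lra).
destruct (Hlim eta Pe) as [n1 Hn1].
assert (forall n, (n <= phi n)%nat) as Pphi.
{ induction n; [lia|]. specialize (Hphi n). lia. }
pose proof (proj1 Hh) as Ah.
assert (forall n, analytic_on_disc (V_op g (monomial n))) as AV
  by (intros; apply V_op_analytic; [easy|apply analytic_pow]).
assert (forall n, analytic_on_disc (fun z => V_op g (monomial n) z - h z)%C) as AD.
{ intros n. apply (analytic_ext (fun z => V_op g (monomial n) z + (-1) * h z)%C); [intros; ring|].
  apply analytic_plus; [easy|]. apply analytic_mult; [apply analytic_const|easy]. }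
assert (forall n r, (n1 <= n)%nat -> 0 <= r < 1 ->
  pb p (fun t => V_op g (monomial (phi n)) (circle_point r t) - h (circle_point r t))%C eta) as D.
{ intros n r Hn. apply (hardy_norm_le p (fun z => V_op g (monomial (phi n)) z - h z)%C); auto.
  now apply Rbar_lt_le, Hn1. }
assert (forall r, 0 <= r < 1 -> pb p (fun t => h (circle_point r t)) (8 * eta)) as Hs.
{ intros r Hr. destruct (V_op_monomial_small r eta Hr Pe) as [n2 Hn2].
  set (n := (n1 + n2)%nat).
  apply (pb_dom p _ (fun t => (-1) * (V_op g (monomial (phi n)) (circle_point r t) - h (circle_point r t))
    + V_op g (monomial (phi n)) (circle_point r t))%C); auto.
  - now apply analytic_pcont.
  - apply pcont_plus; [|now apply (analytic_pcont (V_op g (monomial (phi n))))].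
    apply pcont_scal, (analytic_pcont _ r (AD (phi n)) Hr).
  - lra.
  - intros t. right. f_equal. ring.
  - replace (8 * eta) with (4 * (Cmod (-1) * eta + eta)).
    2:{ rewrite Cmod_R, Rabs_left by lra. ring. }
    apply (pb_plus p (fun t => (-1) * (V_op g (monomial (phi n)) (circle_point r t) - h (circle_point r t)))%C
      (fun t => V_op g (monomial (phi n)) (circle_point r t))); auto.
    + apply pcont_scal, (analytic_pcont _ r (AD (phi n)) Hr).
    + now apply (analytic_pcont (V_op g (monomial (phi n)))).
    + apply Rmult_le_pos; [apply Cmod_ge_0|lra].
    + lra.
    + apply pb_scal; auto; [apply (analytic_pcont _ r (AD (phi n)) Hr)|lra|].
      apply D; [unfold n; lia|easy].
    + apply pb_const; auto; [now apply (analytic_pcont (V_op g (monomial (phi n))))|lra|].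
      intros t. apply Hn2. specialize (Pphi n). unfold n in *. lia. }
set (n := (n1 + N)%nat). exists (phi n). split; [specialize (Pphi n); unfold n in *; lia|].
intros r Hr.
apply (pb_dom p _ (fun t => (V_op g (monomial (phi n)) (circle_point r t) - h (circle_point r t))
  + h (circle_point r t))%C); auto.
- now apply (analytic_pcont (V_op g (monomial (phi n)))).
- apply pcont_plus; [apply (analytic_pcont _ r (AD (phi n)) Hr)|now apply analytic_pcont].
- lra.
- intros t. right. f_equal. ring.
- replace eps with (4 * (eta + 8 * eta)) by (unfold eta; field).
  apply (pb_plus p (fun t => V_op g (monomial (phi n)) (circle_point r t) - h (circle_point r t))%C
    (fun t => h (circle_point r t))); auto; try lra.
  + apply (analytic_pcont _ r (AD (phi n)) Hr).
  + now apply analytic_pcont.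
  + apply D; [unfold n; lia|easy].
Qed.

(** Multiplied by its coefficient [c + 1], the selected term contributes exactly [/ 8 ^ S c]. *)
Definition threshold (c : nat) : R := / INR (S c) * / 8 ^ S c.

(** Counts the exponents selected below [n]; this count fixes both the next coefficient and the next
    threshold. *)
Fixpoint picked (n : nat) : nat :=
  match n with
  | O => O
  | S m => if excluded_middle_informative (small m (threshold (picked m)))
           then S (picked m) else picked m
  end.

(* Greedy lacunary choice: the exponent [n] is used, with the next integer as
   coefficient, exactly when [V z^n] is small enough. *)
Definition greedy_coef (n : nat) : C :=
  if excluded_middle_informative (small n (threshold (picked n)))
  then RtoC (INR (S (picked n))) else RtoC 0.

Lemma picked_le (n : nat) : (picked n <= n)%nat.
Proof.
induction n as [|n IH]; [easy|]. simpl. destruct (excluded_middle_informative _); lia.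
Qed.

(** Since [picked n <= n], the coefficients are dominated by [n + 1], those of the derivative of the
    geometric series. *)
Lemma absc_greedy_coef : absc greedy_coef.
Proof.
intros r Hr.
assert (absc (fun _ => RtoC 1)) as H1.
{ intros s Hs. apply (ex_series_ext (fun n => s ^ n)).
  - intros n. rewrite Cmod_1. symmetry. apply Rmult_1_l.
  - apply ex_series_geom. rewrite Rabs_pos_eq; lra. }
apply (ex_series_le (V := R_CompleteNormedModule) _ _) with (2 := absc_dcoef _ H1 r Hr).
intros n. change (norm ?x) with (Rabs x). assert (0 <= r ^ n) by (apply pow_le; lra).
rewrite Rabs_pos_eq by (apply Rmult_le_pos; [apply Cmod_ge_0|easy]).
apply Rmult_le_compat_r; [easy|]. unfold dcoef. rewrite Cmult_1_r, Cmod_R, Rabs_pos_eq by apply pos_INR.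
unfold greedy_coef. destruct (excluded_middle_informative _).
- rewrite Cmod_R, Rabs_pos_eq by apply pos_INR. apply le_INR. pose proof (picked_le n). lia.
- rewrite Cmod_0. apply pos_INR.
Qed.

(** If the count stuck at [c], no later exponent would meet [threshold c], against
    [compact_small]. *)
Lemma greedy_coef_unbounded (hc : compact_operator (hardy p) (hardy_norm p) (V_op g)) (K : nat) :
  exists n, greedy_coef n = RtoC (INR (S K)).
Proof.
enough (exists n, picked n = K /\ small n (threshold K)) as [n [E H]].
{ exists n. unfold greedy_coef. rewrite E. now destruct (excluded_middle_informative _). }
assert (forall c n0, picked n0 = c -> exists n, picked n = c /\ small n (threshold c)) as A.
{ intros c n0 E0. apply NNPP. intros N.
  assert (forall d, picked (n0 + d) = c) as Const.
  { induction d as [|d IH]; [now rewrite Nat.add_0_r|]. rewrite Nat.add_succ_r. simpl. rewrite IH.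
    destruct (excluded_middle_informative _) as [S1|]; [|easy].
    exfalso. apply N. now exists (n0 + d)%nat. }
  destruct (compact_small hc (threshold c) n0) as [n [Hn Hsm]].
  - unfold threshold. apply Rmult_lt_0_compat; apply Rinv_0_lt_compat.
    + apply lt_0_INR. lia.
    + apply pow_lt. lra.
  - apply N. exists n. split; [|easy]. replace n with (n0 + (n - n0))%nat by lia. apply Const. }
induction K as [|K [n [E H]]]; [now apply (A O O)|].
apply (A (S K) (S n)). simpl. rewrite E. now destruct (excluded_middle_informative _).
Qed.

(** The recursion splits off the lowest exponent: each addition costs a factor 4 on everything that
    remains, and the higher terms, being smaller, can afford it. *)
Fixpoint segment (m L : nat) : C -> C :=
  match L with
  | O => fun _ => RtoC 0
  | S L' => fun z => (greedy_coef m * monomial m z + segment (S m) L' z)%C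
  end.

Lemma segment_csum (L : nat) : forall m z,
  segment m L z = csum (fun k => greedy_coef (m + k) * z ^ (m + k))%C L.
Proof.
induction L as [|L IH]; intros m z; [easy|].
cbn [segment]. rewrite csum_head, IH, Nat.add_0_r. unfold monomial. f_equal.
apply csum_ext. intros k. now rewrite Nat.add_succ_r.
Qed.

Lemma analytic_scaled_monomial (c : C) (m : nat) : analytic_on_disc (fun z => c * monomial m z)%C.
Proof. apply analytic_mult; [apply analytic_const|apply analytic_pow]. Qed.

Lemma analytic_segment (L : nat) : forall m, analytic_on_disc (segment m L).
Proof.
induction L as [|L IH]; intros m; [apply analytic_const|].
apply analytic_plus; [apply analytic_scaled_monomial|apply IH].
Qed.

(** With [c = picked m], a selected exponent gives [4 * (/ 8 ^ S c + / 8 ^ S c) = / 8 ^ c]; an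
    unselected one changes neither the sum nor the count. Hence the bound is independent of the
    length [L]. *)
Lemma segment_bound (L : nat) : forall m r, 0 <= r < 1 ->
  pb p (fun t => V_op g (segment m L) (circle_point r t)) (/ 8 ^ picked m).
Proof.
assert (forall k, 0 < / 8 ^ k) as P8 by (intros; apply Rinv_0_lt_compat, pow_lt; lra).
assert (forall m L r, 0 <= r < 1 -> pcont (fun t => V_op g (segment m L) (circle_point r t))) as PC.
{ intros m L' r Hr. apply (analytic_pcont (V_op g (segment m L'))); [|easy].
  apply V_op_analytic; [easy|apply analytic_segment]. }
induction L as [|L IH]; intros m r Hr; pose proof (P8 (picked m)) as Pm.
- apply pb_const; auto; [lra|]. intros t. cbn [segment].
  rewrite (V_op_primitive g hg (fun _ => RtoC 0) (fun _ => RtoC 0)).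
  + replace (0 - 0)%C with (RtoC 0) by ring. rewrite Cmod_0. lra.
  + apply analytic_const.
  + intros w Hw. rewrite Cmult_0_l. apply cderiv_const.
  + now apply circle_point_disc.
- assert (forall t, V_op g (segment m (S L)) (circle_point r t)
    = (greedy_coef m * V_op g (monomial m) (circle_point r t)
       + V_op g (segment (S m) L) (circle_point r t))%C) as E.
  { intros t. pose proof (circle_point_disc r t Hr) as Dt. cbn [segment].
    rewrite V_op_plus; auto using analytic_scaled_monomial, analytic_segment.
    rewrite V_op_scal; auto. apply analytic_pow. }
  assert (pcont (fun t => V_op g (monomial m) (circle_point r t))) as PCm.
  { apply (analytic_pcont (V_op g (monomial m))); [|easy].
    apply V_op_analytic; [easy|apply analytic_pow]. }
  specialize (IH (S m) r Hr).
  set (u := fun t => (greedy_coef m * V_op g (monomial m) (circle_point r t)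
       + V_op g (segment (S m) L) (circle_point r t))%C).
  apply (pb_dom p _ u); auto.
  { unfold u. apply pcont_plus; [now apply pcont_scal|now apply PC]. }
  { lra. }
  { intros t. rewrite E. unfold u. lra. }
  unfold u. simpl in IH. unfold greedy_coef.
  destruct (excluded_middle_informative _) as [Sm|_].
  + set (c := picked m) in *.
    assert (0 < INR (S c)) as Pc by (apply lt_0_INR; lia).
    pose proof (P8 (S c)) as PSc.
    replace (/ 8 ^ c) with (4 * (Cmod (RtoC (INR (S c))) * threshold c + / 8 ^ S c)).
    2:{ unfold threshold. rewrite Cmod_R, Rabs_pos_eq by lra.
        assert (0 < 8 ^ c) by (apply pow_lt; lra). simpl pow. field. lra. }
    assert (0 <= threshold c) as Pt.
    { unfold threshold. apply Rmult_le_pos; [|lra]. left. now apply Rinv_0_lt_compat. }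
    apply (pb_plus p (fun t => RtoC (INR (S c)) * V_op g (monomial m) (circle_point r t))%C
      (fun t => V_op g (segment (S m) L) (circle_point r t))); auto.
    * now apply pcont_scal.
    * apply Rmult_le_pos; [apply Cmod_ge_0|easy].
    * lra.
    * apply (pb_scal p (fun t => V_op g (monomial m) (circle_point r t))); auto.
  + apply (pb_dom p _ (fun t => V_op g (segment (S m) L) (circle_point r t))); auto.
    * apply pcont_plus; [now apply pcont_scal|now apply PC].
    * lra.
    * intros t. rewrite Cmult_0_l, Cplus_0_l. lra.
Qed.

Lemma optimal_domain_proper (hc : compact_operator (hardy p) (hardy_norm p) (V_op g)) :
  exists f, optimal_domain (V_op g) (hardy p) f /\ ~ hardy p f.
Proof.
destruct (absc_has_psum greedy_coef absc_greedy_coef) as [f Hf].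
pose proof (has_psum_analytic f _ Hf) as Af.
exists f. split.
- split; [easy|]. apply hardy_iff; [easy|]. split; [now apply V_op_analytic|].
  (* On each circle, the partial sum and the tail both have [V]-image bounded by 1, and [pb_plus]
     gives [4 * (1 + 1)]. The cut [N] below depends on [r], but these bounds do not. *)
  exists 8. split; [lra|]. intros r Hr.
  destruct (analytic_bounded (C_derive g) r (analytic_C_derive_analytic g hg) ltac:(lra)) as [B [PB HB]].
  destruct (has_psum_tail f greedy_coef r Hf ltac:(lra) (/ (B + 1))) as [N HN].
  { apply Rinv_0_lt_compat. lra. }
  set (s := segment O N). set (d := fun z => (f z + (-1) * s z)%C).
  assert (analytic_on_disc s) as As by apply analytic_segment.
  assert (analytic_on_disc (fun z => (-1) * s z)%C) as As'.
  { apply analytic_mult; [apply analytic_const|easy]. }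
  assert (analytic_on_disc d) as Ad by now apply analytic_plus.
  pose proof (analytic_pcont _ r (V_op_analytic g hg f Af) Hr) as PCf.
  pose proof (analytic_pcont _ r (V_op_analytic g hg s As) Hr) as PCs.
  pose proof (analytic_pcont _ r (V_op_analytic g hg d Ad) Hr) as PCd.
  apply (pb_dom p _ (fun t => V_op g s (circle_point r t) + V_op g d (circle_point r t))%C);
    auto using pcont_plus; [lra| |].
  + intros t. right. f_equal. unfold d. pose proof (circle_point_disc r t Hr) as Dt.
    rewrite V_op_plus, V_op_scal; auto. ring.
  + replace 8 with (4 * (1 + 1)) by ring.
    apply (pb_plus p (fun t => V_op g s (circle_point r t)) (fun t => V_op g d (circle_point r t))); auto; try lra.
    * replace 1 with (/ 8 ^ picked 0) by (simpl; field). now apply segment_bound.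
    * apply pb_const; auto; [lra|]. intros t.
      apply Rle_trans with (/ (B + 1) * B).
      -- apply (V_op_bound g hg d r); auto using circle_point_disc.
         ++ rewrite Cmod_circle_point, Rabs_pos_eq; lra.
         ++ intros w Hw. unfold d, s. rewrite segment_csum.
            replace (f w + -1 * csum (fun k => greedy_coef (0 + k) * w ^ (0 + k)) N)%C
              with (f w - csum (fun k => greedy_coef k * w ^ k) N)%C by (simpl; ring).
            now apply HN.
      -- apply (Rmult_le_reg_l (B + 1)); [lra|]. rewrite <- Rmult_assoc, Rinv_r; lra.
- intros Hh. destruct (hardy_coef_bounded p f greedy_coef hp Hh Hf) as [M HM].
  destruct (INR_unbounded M) as [K HK]. destruct (greedy_coef_unbounded hc K) as [n En].
  specialize (HM n). rewrite En, Cmod_R, Rabs_pos_eq, S_INR in HM by apply pos_INR. lra.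
Qed.
End Main.

Theorem proposition3p14 (p : Rbar) (hp : Rbar_le 1 p)
  (g : C -> C) (hg : analytic_on_disc g)
  (hc : compact_operator (hardy p) (hardy_norm p) (V_op g)) :
  (forall f : C -> C,
     optimal_domain (V_op g) (hardy p) f <-> optimal_domain (T_op g) (hardy p) f) /\
  proper_subspace (hardy p) (optimal_domain (V_op g) (hardy p)).
Proof.
split.
- intros f. split; intros [Af Hf]; (split; [easy|]); now apply (hardy_V_op_T_op p g hp hg f Af).
- split; [now apply hardy_linear|]. split; [now apply optimal_domain_linear|]. split.
  + intros f Hf. split; [apply Hf|]. now apply hc.
  + now apply optimal_domain_proper.
Qed.
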